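(* Let $n=1$ and, for $k\ge1$, let $\mathcal I_k:=\mathcal I^{(1)}_{k^2}$. There exists a formal symplectic change of variables $e^{\{S,\cdot\}}$, $S\in\mathcal F^{\ge1}$, which preserves all the $M_j$ ($j\in\mathbb Z\setminus\{0\}$) and conjugates all the commuting Hamiltonians $\mathcal I_k$, $k\ge1$ (and consequently all the $J_k$, $k\ge2$, and $H$), to a normal form $\mathcal N_k(\{p_j^2+q_j^2\}_{j\in\mathbb Z\setminus\{0\}})$, i.e. to formal power series depending only on the quantities $p_j^2+q_j^2=2|z_j|^2$.
   Context: Setting: the Kirchhoff-Pohozaev equation $u_{tt}-\big(1+\int_{\mathbb T}|u_x|^2dx\big)^{-2}u_{xx}=0$ on the circle $\mathbb T=\mathbb R/2\pi\mathbb Z$, with Hamiltonian $H(u,v)=\frac12\int_{\mathbb T}v^2dx-\frac12\frac1{1+\int_{\mathbb T}|u_x|^2dx}$ (with $v=u_t$). Functions are real with zero average, $u=\sum_{j\ne0}u_j\frac{e^{ijx}}{\sqrt{2\pi}}$, $v=\sum_{j\ne0}v_j\frac{e^{ijx}}{\sqrt{2\pi}}$, $u_{-j}=\bar u_j$, $v_{-j}=\bar v_j$. Constants of motion: for $k\ge1$, $D_k=\sum_{j\ne0}|j|^{2k}|u_j|^2$, $B_k=\sum_{j\ne0}|j|^{2k-2}|v_j|^2$, $Q_k=\sum_{j\ne0}|j|^{2k-2}u_j\bar v_j$, $A=\frac1{1+D_1}$, $E_k=\frac{B_k}A+AD_k$, $F_k=\frac{B_k}A-AD_k$; for $k\ge2$,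 $J_k=E_k-\sum_{j=2}^kQ_jQ_{k+2-j}+\frac14\sum_{j=2}^{k-1}(E_jE_{k+1-j}-F_jF_{k+1-j})$. For $\nu\in\Lambda=\{m^2:m\in\mathbb N_{\ge1}\}$ and $S_\nu=\{j\in\mathbb Z\setminus\{0\}:j^2=\nu\}$, $$\mathcal I^{(1)}_\nu=\sum_{j\in S_\nu}\Big(A\nu|u_j|^2+|v_j|^2+\sum_{\nu'\in\Lambda,\,\nu'\neq\nu}\sum_{k\in S_{\nu'}}\frac{\nu\nu'}{\nu-\nu'}|u_jv_k-u_kv_j|^2\Big),\qquad M_j=\frac12(u_jv_{-j}-u_{-j}v_j).$$ Complex coordinates: $z_j=\frac{|j|^{1/2}u_j+i|j|^{-1/2}v_j}{\sqrt2}$, $\bar z_j=\frac{|j|^{1/2}u_{-j}-i|j|^{-1/2}v_{-j}}{\sqrt2}$, and $z_j=(p_j+iq_j)/\sqrt2$; up to a constant factor $M_j$ equals $|z_j|^2-|z_{-j}|^2$. All functions above are regarded as formal power series in $(z,\bar z)$ (with $A=(1+D_1)^{-1}$ Taylor expanded in $D_1$); additive constants are irrelevant. Formal power series: let $I=\mathbb Z\setminus\{0\}$ and $\mathbb N^I_f$ the finitely supported sequences of non-negative integers. $\mathcal F$ is the space of formal power series $\sum_{\alpha,\beta\in\mathbb N^I_f}H_{\alpha,\beta}z^\alpha\bar z^\beta$, $z^\alpha=\prod_jz_j^{\alpha_j}$, without constant and linear terms, with $H_{\alpha,\beta}=\overline{H_{\beta,\alpha}}$ and $H_{\alpha,\beta}=0$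 unless $\sum_{j}j(\alpha_j-\beta_j)=0$. It is a Poisson algebra with $\{F,G\}=i\sum F_{\alpha^1,\beta^1}G_{\alpha^2,\beta^2}\sum_j(\alpha^1_j\beta^2_j-\beta^1_j\alpha^2_j)z^{\alpha^1+\alpha^2-\mathbf e_j}\bar z^{\beta^1+\beta^2-\mathbf e_j}$, where $\mathbf e_j$ is the $j$-th unit vector. $\mathcal F^{\ge1}$ is the subspace of series all of whose monomials have total degree $|\alpha|+|\beta|\ge3$. For $S\in\mathcal F^{\ge1}$ the formal symplectic change of variables generated by $S$ is the operator $e^{\{S,\cdot\}}=\sum_{k\ge0}\frac{\mathrm{ad}_S^k}{k!}$, $\mathrm{ad}_S=\{S,\cdot\}$; it conjugates $G$ to $e^{\{S,\cdot\}}G$, and it preserves $M_j$ if $e^{\{S,\cdot\}}M_j=M_j$. *)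

(* Defs.v *)
From HB Require Import structures.
From mathcomp Require Import all_boot all_order all_algebra.
From mathcomp Require Import finmap multiset complex.
From mathcomp Require Import boolp classical_sets functions cardinality fsbigop.
From mathcomp Require Import reals ring.

Set Implicit Arguments.
Unset Strict Implicit.
Unset Printing Implicit Defensive.

Import Order.TTheory GRing.Theory Num.Theory.
Local Open Scope classical_set_scope.
Local Open Scope ring_scope.

Definition idx := {j : int | j != 0}.

Definition idx_opp (j : idx) : idx :=
  exist (fun i : int => i != 0) (- val j)
    (etrans (congr1 negb (oppr_eq0 (val j))) (valP j)).

Lemma idx_oppK : involutive idx_opp.
Proof. by move=> j; apply/val_inj => /=; rewrite opprK. Qed.

Definition absj (j : idx) : nat := `|val j|%N.

Lemma absj_opp j : absj (idx_opp j) = absj j.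
Proof. exact: abszN. Qed.

Lemma absj_gt0 j : (0 < absj j)%N.
Proof. by rewrite absz_gt0 (valP j). Qed.

(* finitely supported sequences idx -> nat, with pointwise addition *)
Definition expo : Type := {mset idx}%mset.
HB.instance Definition _ := Choice.on expo.

Definition expo_add (a b : expo) : expo := msetD a b.

Lemma expo_addA : associative expo_add. Proof. exact: msetDA. Qed.
Lemma expo_addC : commutative expo_add. Proof. exact: msetDC. Qed.
Lemma expo_add0 : left_id (mset0 : expo) expo_add. Proof. exact: mset0D. Qed.

HB.instance Definition _ :=
  GRing.isNmodule.Build expo expo_addA expo_addC expo_add0.

Lemma expoP (a b : expo) : (forall j, a j = b j) -> a = b.
Proof. by move=> h; apply/msetP. Qed.

Lemma expoD (a b : expo) j : (a + b) j = (a j + b j)%N.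
Proof. by rewrite [in LHS]/GRing.add /= msetE2. Qed.

Lemma expo0 j : (0 : expo) j = 0%N.
Proof. exact: mset0E. Qed.

Definition unitv (j : idx) : expo := [mset j]%mset.

Lemma unitvE i j : unitv i j = (j == i).
Proof. by rewrite msetnE; case: eqP. Qed.

Definition supp (a : expo) : {fset idx} := finsupp a.

(* (a, b) stands for the monomial z^a zbar^b *)
Notation mono := (expo * expo)%type.

Definition mdeg (m : mono) : nat :=
  (\sum_(j <- supp m.1) m.1 j + \sum_(j <- supp m.2) m.2 j)%N.

Lemma supp_sum (a : expo) (P : {fset idx}) : (supp a `<=` P)%fset ->
  (\sum_(j <- P) a j = \sum_(j <- supp a) a j)%N.
Proof.
move=> aP; apply/esym; apply: big_fset_incl => //.
by move=> j _; rewrite memNfinsupp => /eqP.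
Qed.

Lemma mdegD x y : mdeg (x + y) = (mdeg x + mdeg y)%N.
Proof.
suff D (a b : expo) : (\sum_(j <- supp (a + b)%R) (a + b)%R j =
    \sum_(j <- supp a) a j + \sum_(j <- supp b) b j)%N.
  by rewrite /mdeg !D addnACA.
pose P := (supp a `|` supp b `|` supp (a + b)%R)%fset.
have [aP bP cP] : [/\ supp a `<=` P, supp b `<=` P & supp (a + b)%R `<=` P]%fset.
  by split; apply/fsubsetP => j jP; rewrite !in_fsetU jP ?orbT.
rewrite -(supp_sum aP) -(supp_sum bP) -(supp_sum cP) -big_split.
by apply: eq_bigr => j _; apply: expoD.
Qed.

Lemma mdeg0 : mdeg 0 = 0%N.
Proof.
have /eqP := mdegD 0 0.
by rewrite addr0 -[X in X == _]addn0 eqn_add2l eq_sym => /eqP.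
Qed.

Lemma mdeg_eq0 m : mdeg m = 0%N -> m = 0.
Proof.
suff D (a : expo) : (\sum_(j <- supp a) a j = 0)%N -> a = 0.
  by case: m => a b /eqP; rewrite addn_eq0 => /andP[/eqP/D + /eqP/D] => /= -> ->.
move=> /eqP; rewrite sum_nat_seq_eq0 => /allP a0; apply/expoP => j.
rewrite expo0; apply/eqP; have [/a0|] := boolP (j \in supp a); first by [].
by rewrite memNfinsupp.
Qed.

Definition momentum (m : mono) : int :=
  \sum_(j \in [set: idx]) val j * ((m.1 j)%:Z - (m.2 j)%:Z).

Lemma finite_expo_le (a : expo) :
  finite_set [set b : expo | forall j, (b j <= a j)%N].
Proof.
pose n := \max_(j : supp a) a (val j).
pose g (f : {ffun supp a -> 'I_n.+1}) : expo :=
  [fsfun j : supp a => (f j : nat) | 0%N].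
apply: (@sub_finite_set _ _ (range g)); last exact: finite_image.
move=> b /= ba.
exists [ffun j : supp a => inord (b (val j))] => //.
apply/expoP => j; rewrite /g fsfun_ffun.
case: insubP => [u _ uj|].
- rewrite /= ffunE inordK uj // ltnS.
  apply: leq_trans (ba _) _; rewrite -uj.
  exact: (leq_bigmax (F := fun j : supp a => a (val j)) u).
- rewrite /= memNfinsupp => /eqP aj0.
  by have := ba j; rewrite [a j]aj0 leqn0 => /eqP.
Qed.

Definition decomp (m : mono) : set (mono * mono) := [set p | p.1 + p.2 = m].

Definition divs (m : mono) : set mono := [set x | exists y, x + y = m].

Lemma finite_divs m : finite_set (divs m).
Proof.
apply: (@sub_finite_set _ _
  ([set b : expo | forall j, (b j <= m.1 j)%N] `*`
   [set b : expo | forall j, (b j <= m.2 j)%N])); last first.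
  by apply: finite_setX; apply: finite_expo_le.
move=> x [y <-]; split=> j /=.
- by rewrite (expoD x.1 y.1) leq_addr.
- by rewrite (expoD x.2 y.2) leq_addr.
Qed.

Lemma finite_decomp m : finite_set (decomp m).
Proof.
apply: (@sub_finite_set _ _ (divs m `*` divs m)); last first.
  by apply: finite_setX; apply: finite_divs.
move=> [x y] /= xy; split; first by exists y.
by exists x; rewrite addrC.
Qed.

Record fps (K : comNzRingType) := FPS { coef :> mono -> K }.
Arguments FPS {K} _.

Section Ring.
Variable K : comNzRingType.
Implicit Types F G H : fps K.

HB.instance Definition _ := gen_eqMixin (fps K).
HB.instance Definition _ := gen_choiceMixin (fps K).

Lemma fpsP F G : (forall m, F m = G m) -> F = G.
Proof. by case: F G => [f] [g] /= fg; congr FPS; apply/funext. Qed.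

Definition fps_zero : fps K := FPS (fun=> 0).
Definition fps_add F G : fps K := FPS (fun m => F m + G m).
Definition fps_opp F : fps K := FPS (fun m => - F m).
Definition fps_one : fps K := FPS (fun m => (m == 0)%:R).
Definition fps_mul F G : fps K :=
  FPS (fun m => \sum_(p \in decomp m) F p.1 * G p.2).
Definition fps_scale (c : K) F : fps K := FPS (fun m => c * F m).

Lemma fps_addA : associative fps_add.
Proof. by move=> F G H; apply/fpsP => m /=; rewrite addrA. Qed.
Lemma fps_addC : commutative fps_add.
Proof. by move=> F G; apply/fpsP => m /=; rewrite addrC. Qed.
Lemma fps_add0 : left_id fps_zero fps_add.
Proof. by move=> F; apply/fpsP => m /=; rewrite add0r. Qed.
Lemma fps_addN : left_inverse fps_zero fps_opp fps_add.
Proof. by move=> F; apply/fpsP => m /=; rewrite addNr. Qed.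

HB.instance Definition _ :=
  GRing.isZmodule.Build (fps K) fps_addA fps_addC fps_add0 fps_addN.

Lemma fps_mul_divs m x (P : {fset mono}) F G :
    (forall y, divs m y -> y \in P) -> divs m x ->
  fps_mul F G x = \sum_(a <- P) \sum_(b <- P) (a + b == x)%:R * (F a * G b).
Proof.
move=> mP [x' xx'] /=.
have subP p : decomp x p -> (p.1 \in P) /\ (p.2 \in P).
  case: p => [a b] /= ab; split; apply: mP.
  - by exists (b + x'); rewrite addrA ab.
  - by exists (a + x'); rewrite addrA (addrC b) ab.
rewrite [RHS]fsbig_seq ?fset_uniq //.
transitivity (\sum_(a \in [set` P]) \sum_(b \in [set` P])
    (a + b == x)%:R * (F a * G b)); last first.
  by apply: eq_fsbigr => a _; rewrite [RHS]fsbig_seq ?fset_uniq.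
rewrite pair_fsbig ?finite_fset //.
transitivity (\sum_(p \in decomp x) (p.1 + p.2 == x)%:R * (F p.1 * G p.2)).
  by apply: eq_fsbigr => p; rewrite inE /decomp /= => ->; rewrite eqxx mul1r.
apply: fsbig_widen => p; first by move=> /subP.
by move=> [_ /eqP px] /=; rewrite (negbTE px) mul0r.
Qed.

Lemma fps_mulA : associative fps_mul.
Proof.
move=> F G H; apply/fpsP => m.
have [P mP] := finite_fsetP.1 (finite_divs m).
have inP y : divs m y -> y \in P by rewrite mP.
have Pdiv y : y \in P -> divs m y by rewrite mP.
have mm : divs m m by exists 0; rewrite addr0.
rewrite !(fps_mul_divs _ _ inP mm).
under eq_big_seq => a /Pdiv am.
  under eq_big_seq => b /Pdiv bm.
    rewrite (fps_mul_divs _ _ inP bm) !mulr_sumr.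
    under eq_bigr => c _ do rewrite !mulr_sumr.
    over.
  over.
under [RHS]eq_big_seq => a /Pdiv am.
  under eq_bigr => b _.
    rewrite (fps_mul_divs _ _ inP am) mulr_suml mulr_sumr.
    under eq_bigr => c _ do rewrite mulr_suml mulr_sumr.
    over.
  over.
transitivity (\sum_(a <- P) \sum_(b <- P) \sum_(c <- P)
   (a + b + c == m)%:R * (F a * (G b * H c))).
  apply: eq_big_seq => a aP; rewrite exchange_big; apply: eq_big_seq => b bP.
  rewrite exchange_big; apply: eq_big_seq => c cP /=.
  have [abc|abc] := eqVneq (a + b + c) m.
    rewrite (bigD1_seq (b + c)) ?fset_uniq //=; last first.
      by apply: inP; exists a; rewrite -abc addrC addrA.
    rewrite addrA abc !eqxx !mul1r big1 ?addr0 // => x /negbTE xbc.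
    by rewrite [b + c == x]eq_sym xbc mul0r mulr0 mulr0.
  rewrite mul0r big1_seq // => x _.
  have [<-|_] := eqVneq (b + c) x; last by rewrite mul0r !mulr0.
  by rewrite addrA (negbTE abc) mul0r.
symmetry; rewrite exchange_big /=.
under eq_bigr => c _.
  rewrite exchange_big /=.
  under eq_bigr => a _ do rewrite exchange_big /=.
  over.
rewrite exchange_big /=; apply: eq_big_seq => a aP.
rewrite exchange_big /=; apply: eq_big_seq => b bP.
apply: eq_big_seq => c cP.
have [abc|abc] := eqVneq (a + b + c) m.
  rewrite (bigD1_seq (a + b)) ?fset_uniq //=; last by apply: inP; exists c.
  rewrite abc !eqxx !mul1r -mulrA big1 ?addr0 // => x /negbTE xab.
  by rewrite [a + b == x]eq_sym xab mul0r mul0r mulr0.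
rewrite mul0r big1_seq // => x _.
have [<-|_] := eqVneq (a + b) x; last by rewrite !mul0r mulr0.
by rewrite (negbTE abc) mul0r.
Qed.

Lemma fps_mulC : commutative fps_mul.
Proof.
move=> F G; apply/fpsP => m.
have [P mP] := finite_fsetP.1 (finite_divs m).
have inP y : divs m y -> y \in P by rewrite mP.
have mm : divs m m by exists 0; rewrite addr0.
rewrite !(fps_mul_divs _ _ inP mm) exchange_big /=.
by apply: eq_bigr => a _; apply: eq_bigr => b _; rewrite addrC (mulrC (F b)).
Qed.

Lemma fps_mul1 : left_id fps_one fps_mul.
Proof.
move=> F; apply/fpsP => m /=.
transitivity (\sum_(p \in [set ((0 : mono), m)]) (p.1 == 0)%:R * F p.2).
  apply/esym/fsbig_widen => [p ->|[x y]] /=; first exact: add0r.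
  move=> [xy nxy]; have [x0|] := eqVneq x 0; last by rewrite mul0r.
  by case: nxy; rewrite -xy x0 add0r.
by rewrite fsbig_set1 /= eqxx mul1r.
Qed.

Lemma fps_mulDl : left_distributive fps_mul +%R.
Proof.
move=> F G H; apply/fpsP => m /=.
rewrite !(fsbig_finite _ _ (finite_decomp m)) /= -big_split /=.
by apply: eq_bigr => p _; rewrite mulrDl.
Qed.

Lemma fps_oner_neq0 : fps_one != 0.
Proof.
apply/eqP => /(congr1 (fun F : fps K => F 0)) /= /eqP.
by rewrite eqxx oner_eq0.
Qed.

HB.instance Definition _ := GRing.Zmodule_isComNzRing.Build (fps K)
  fps_mulA fps_mulC fps_mul1 fps_mulDl fps_oner_neq0.

Lemma fps_scaleA a b F : fps_scale a (fps_scale b F) = fps_scale (a * b) F.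
Proof. by apply/fpsP => m /=; rewrite mulrA. Qed.
Lemma fps_scale1 : left_id 1 fps_scale.
Proof. by move=> F; apply/fpsP => m /=; rewrite mul1r. Qed.
Lemma fps_scaleDr : right_distributive fps_scale +%R.
Proof. by move=> c F G; apply/fpsP => m /=; rewrite mulrDr. Qed.
Lemma fps_scaleDl F : {morph fps_scale^~ F : a b / a + b}.
Proof. by move=> a b; apply/fpsP => m /=; rewrite mulrDl. Qed.

HB.instance Definition _ := GRing.Zmodule_isLmodule.Build K (fps K)
  fps_scaleA fps_scale1 fps_scaleDr fps_scaleDl.

Lemma fps_scaleAl (c : K) F G : c *: (F * G) = (c *: F) * G.
Proof.
apply/fpsP => m /=; rewrite (fsbig_finite _ _ (finite_decomp m)) /=.
rewrite (fsbig_finite _ _ (finite_decomp m)) /= mulr_sumr.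
by apply: eq_bigr => p _; rewrite mulrA.
Qed.

HB.instance Definition _ := GRing.Lmodule_isLalgebra.Build K (fps K) fps_scaleAl.
HB.instance Definition _ := GRing.Lalgebra_isComAlgebra.Build K (fps K).

Lemma fpsD F G m : (F + G) m = F m + G m. Proof. by []. Qed.
Lemma fpsN F m : (- F) m = - F m. Proof. by []. Qed.
Lemma fpsZ c F m : (c *: F) m = c * F m. Proof. by []. Qed.
Lemma fps1 m : (1 : fps K) m = (m == 0)%:R. Proof. by []. Qed.
Lemma fpsM F G m : (F * G) m = \sum_(p \in decomp m) F p.1 * G p.2.
Proof. by []. Qed.

Lemma fpsX_deg F n m : F 0 = 0 -> (mdeg m < n)%N -> (F ^+ n) m = 0.
Proof.
move=> F0; elim: n m => // n IH m; rewrite ltnS => mn.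
rewrite exprS fpsM; apply: fsbig1 => -[x y] /= xy.
have [/mdeg_eq0 ->|x0] := eqVneq (mdeg x) 0%N; first by rewrite F0 mul0r.
rewrite IH ?mulr0 //; apply: leq_trans mn.
by rewrite -xy mdegD -[X in (X < _)%N]add0n ltn_add2r lt0n.
Qed.

(* possibly infinite sums, taken monomial by monomial: they are meaningful when
   each monomial occurs in finitely many of the [f t] *)
Definition fps_sum (T : choiceType) (A : set T) (f : T -> fps K) : fps K :=
  FPS (fun m => \sum_(t \in A) f t m).

Lemma fps_geometric F : F 0 = 0 ->
  fps_sum [set: nat] (fun n => F ^+ n) * (1 - F) = 1.
Proof.
move=> F0; apply/fpsP => m.
transitivity (((\sum_(n < (mdeg m).+1) F ^+ n) * (1 - F)) m).
  rewrite !fpsM; apply: eq_fsbigr => -[x y]; rewrite inE => /= xy; congr (_ * _).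
  transitivity (\sum_(n < (mdeg m).+1) (F ^+ n) x); last first.
    by elim/big_rec2: _ => [//|n a G _ ->]; rewrite fpsD.
  rewrite -(big_mkord xpredT (fun n => (F ^+ n) x)).
  rewrite (fsbigE (index_iota 0 (mdeg m).+1)) ?iota_uniq //.
    by under eq_bigl do rewrite in_setT.
  move=> n _; rewrite mem_index_iota /= -leqNgt => mn; apply: fpsX_deg => //.
  by apply: leq_trans mn; rewrite ltnS -xy mdegD leq_addr.
rewrite mulrC -opprB mulNr -subrX1 opprB fpsD fpsN fpsX_deg ?oppr0 ?addr0 //.
Qed.

Definition z_ (j : idx) : fps K := FPS (fun m => (m == (unitv j, 0))%:R).
Definition zb_ (j : idx) : fps K := FPS (fun m => (m == (0, unitv j))%:R).

End Ring.

Arguments z_ {K} j.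
Arguments zb_ {K} j.

Section Inversion.
Variables (K : fieldType) (x y a s i : K).
Hypotheses (a0 : a != 0) (s0 : s != 0) (s2 : s ^+ 2 = 1 + 1) (i0 : i != 0).

Let half (t : K) : (t + t) / s ^+ 2 = t.
Proof.
have n2 : (1 + 1 : K) != 0 by rewrite -s2 expf_neq0.
by rewrite s2 -[t in t + t]mulr1 -mulrDr mulfK.
Qed.

Lemma inversion_sum :
  s^-1 * (a * ((a * s)^-1 * (x + y)) + (i / a) * (a / (s * i) * (x - y))) = x.
Proof. by rewrite -[RHS]half; field; rewrite a0 s0 i0. Qed.

Lemma inversion_diff :
  s^-1 * (a * ((a * s)^-1 * (x + y)) - (i / a) * (a / (s * i) * (x - y))) = y.
Proof. by rewrite -[RHS]half; field; rewrite a0 s0 i0. Qed.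

Lemma inversion_pq :
  s^-1 * (s^-1 * (x + y) + i * ((s * i)^-1 * (x - y))) = x.
Proof. by rewrite -[RHS]half; field; rewrite s0 i0. Qed.
End Inversion.

Lemma conj_real_scale (K : numClosedFieldType) (c : K) (m n : nat) :
  0 <= c -> (c * (m%:R + n%:R))^* = c * (m%:R + n%:R).
Proof.
by move=> c0; rewrite -natrD rmorphM /= conjC_nat (conj_Creal (ger0_real c0)).
Qed.

Section Poisson.
Variable R : realType.
Implicit Types F G H S : fps R[i].

(* complex conjugation, exchanging z_j and zbar_j *)
Definition fps_conj F : fps R[i] := FPS (fun m => (F (m.2, m.1))^*).

Definition sqnorm F : fps R[i] := F * fps_conj F.

(* The inner sum runs over (a1, b1) + (a2, b2) = (a + e_j, b + e_j).  When F or G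
   conserves momentum, only finitely many j contribute to a given (a, b). *)
Definition poisson F G : fps R[i] :=
  FPS (fun m => 'i * \sum_(j \in [set: idx])
    \sum_(p \in decomp (m + (unitv j, unitv j)))
      F p.1 * G p.2 * ((p.1.1 j * p.2.2 j)%:R - (p.1.2 j * p.2.1 j)%:R)).

Definition in_F H : Prop :=
  [/\ forall m, (mdeg m <= 1)%N -> H m = 0,
      forall a b : expo, H (a, b) = (H (b, a))^*
    & forall m, momentum m != 0 -> H m = 0].

Definition in_F1 H : Prop := in_F H /\ forall m, (mdeg m < 3)%N -> H m = 0.

Definition exp_ad S G : fps R[i] :=
  fps_sum [set: nat] (fun k => (k`!%:R)^-1 *: iter k (poisson S) G).

Definition p_ (j : idx) : fps R[i] := (sqrtC 2)^-1 *: (z_ j + zb_ j).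
Definition q_ (j : idx) : fps R[i] := (sqrtC 2 * 'i)^-1 *: (z_ j - zb_ j).

Lemma z_pq j : z_ j = (sqrtC 2)^-1 *: (p_ j + 'i *: q_ j).
Proof.
apply/fpsP => m; rewrite !(fpsZ, fpsD, fpsN) inversion_pq //.
- by rewrite sqrtC_eq0 pnatr_eq0.
- by rewrite sqrtCK.
- exact: neq0Ci.
Qed.

Lemma fps_conj_z j : fps_conj (z_ j) = zb_ j.
Proof.
by apply/fpsP => -[a b] /=; rewrite conjC_nat !xpair_eqE andbC.
Qed.

Lemma pq_z j : p_ j ^+ 2 + q_ j ^+ 2 = 2 *: sqnorm (z_ j).
Proof.
rewrite /sqnorm fps_conj_z /p_ /q_ !exprZn !exprVn exprMn sqrCi sqrtCK.
rewrite mulrN1 invrN scaleNr -scalerBr.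
have -> : (z_ j + zb_ j) ^+ 2 - (z_ j - zb_ j) ^+ 2
    = (2 * 2 : R[i]) *: (z_ j * zb_ j) by rewrite -natrM scaler_nat; ring.
by rewrite scalerA mulrA mulVf ?pnatr_eq0 // mul1r.
Qed.

(* formal power series in the variables p_j^2 + q_j^2, with real coefficients *)
Definition normal_form G : Prop :=
  exists N : expo -> R,
    G = fps_sum [set: expo] (fun a =>
      (N a)%:C%C *: \prod_(j <- supp a) (p_ j ^+ 2 + q_ j ^+ 2) ^+ a j).

End Poisson.

Section Kirchhoff.
Variable R : realType.
Local Notation C := R[i].

(* inverse of the complex coordinates, see [z_uv] and [zb_uv] *)
Definition u_ (j : idx) : fps C :=
  (sqrtC (absj j)%:R * sqrtC 2)^-1 *: (z_ j + zb_ (idx_opp j)).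
Definition v_ (j : idx) : fps C :=
  (sqrtC (absj j)%:R / (sqrtC 2 * 'i)) *: (z_ j - zb_ (idx_opp j)).

Let rt0 j : sqrtC (absj j)%:R != 0 :> C.
Proof. by rewrite sqrtC_eq0 pnatr_eq0 -lt0n absj_gt0. Qed.

Let s20 : sqrtC 2 != 0 :> C.
Proof. by rewrite sqrtC_eq0 pnatr_eq0. Qed.

Lemma z_uv j : z_ j = (sqrtC 2)^-1 *:
  (sqrtC (absj j)%:R *: u_ j + ('i / sqrtC (absj j)%:R) *: v_ j).
Proof.
apply/fpsP => m; rewrite !(fpsZ, fpsD, fpsN) inversion_sum ?sqrtCK ?neq0Ci //.
Qed.

Lemma zb_uv j : zb_ j = (sqrtC 2)^-1 *:
  (sqrtC (absj j)%:R *: u_ (idx_opp j)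
    - ('i / sqrtC (absj j)%:R) *: v_ (idx_opp j)).
Proof.
apply/fpsP => m; rewrite !(fpsZ, fpsD, fpsN) absj_opp idx_oppK inversion_diff ?sqrtCK ?neq0Ci //.
Qed.

Lemma conj_u j : fps_conj (u_ j) = u_ (idx_opp j).
Proof.
apply/fpsP => -[a b]; rewrite [RHS]fpsZ fpsD absj_opp idx_oppK.
apply: etrans (conj_real_scale _ _ _) _.
  by rewrite invr_ge0 mulr_ge0 // sqrtC_ge0 ler0n.
congr (_ * _); rewrite addrC /= !xpair_eqE.
by congr (_%:R + _%:R); rewrite andbC.
Qed.

Definition D_ (k : nat) : fps C :=
  fps_sum [set: idx] (fun j => (absj j ^ (2 * k))%:R *: sqnorm (u_ j)).
Definition B_ (k : nat) : fps C :=
  fps_sum [set: idx] (fun j => (absj j ^ (2 * k - 2))%:R *: sqnorm (v_ j)).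
Definition Q_ (k : nat) : fps C :=
  fps_sum [set: idx] (fun j =>
    (absj j ^ (2 * k - 2))%:R *: (u_ j * fps_conj (v_ j))).

(* Taylor expansion of (1 + D_1)^-1, see [A_mulV] *)
Definition A_ : fps C := fps_sum [set: nat] (fun n => (- D_ 1) ^+ n).
Definition Ainv : fps C := 1 + D_ 1.

Definition E_ (k : nat) : fps C := B_ k * Ainv + A_ * D_ k.
Definition F_ (k : nat) : fps C := B_ k * Ainv - A_ * D_ k.

Definition J_ (k : nat) : fps C :=
  E_ k - \sum_(2 <= j < k.+1) Q_ j * Q_ (k + 2 - j)
  + 4^-1 *: \sum_(2 <= j < k) (E_ j * E_ (k + 1 - j) - F_ j * F_ (k + 1 - j)).

Definition Lambda : set nat := [set (m ^ 2)%N | m in [set m : nat | (1 <= m)%N]].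
Definition S_ (nu : nat) : set idx := [set j | val j ^+ 2 = nu%:Z].

Definition I1 (nu : nat) : fps C :=
  fps_sum (S_ nu) (fun j =>
    nu%:R *: (A_ * sqnorm (u_ j)) + sqnorm (v_ j)
    + fps_sum (Lambda `\ nu) (fun nu' =>
        fps_sum (S_ nu') (fun k =>
          ((nu * nu')%:R / (nu%:R - nu'%:R)) *:
            sqnorm (u_ j * v_ k - u_ k * v_ j)))).

Definition I_ (k : nat) : fps C := I1 (k ^ 2).

Definition M_ (j : idx) : fps C :=
  2^-1 *: (u_ j * v_ (idx_opp j) - u_ (idx_opp j) * v_ j).

Lemma u_coef0 j : u_ j 0 = 0.
Proof.
have n0 i : unitv i != 0.
  apply/eqP => /(congr1 (fun a : expo => a i)).
  by rewrite unitvE expo0 eqxx.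
rewrite fpsZ fpsD /= !xpair_eqE /= !(eq_sym 0 (unitv _)).
by rewrite !(negbTE (n0 _)) andbF addr0 mulr0.
Qed.

Lemma A_mulV : A_ * Ainv = 1.
Proof.
rewrite /Ainv -[D_ 1]opprK; apply: fps_geometric.
rewrite fpsN -[RHS]oppr0; congr (- _); apply: fsbig1 => j _.
rewrite fpsZ fpsM [X in _ * X]fsbig1 ?mulr0 // => -[x y] xy.
have {}xy : x + y = 0 := xy.
suff x0 : x = 0 by rewrite [(x, y).1]/= x0 u_coef0 mul0r.
apply: mdeg_eq0; apply/eqP; rewrite -leqn0 -[X in (_ <= X)%N](_ : mdeg (x + y) = _).
  by rewrite mdegD leq_addr.
by rewrite xy mdeg0.
Qed.

(* By Parseval, the integrals of v^2 and |u_x|^2 are B_1 and D_1. *)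
Definition H_ : fps C := 2^-1 *: B_ 1 - 2^-1 *: A_.

End Kirchhoff.

(* Main.v *)
Require Import Defs.
From mathcomp Require Import all_boot all_order all_algebra.
From mathcomp Require Import finmap multiset complex.
From mathcomp Require Import boolp classical_sets functions cardinality fsbigop.
From mathcomp Require Import reals ring zify.

(** Everything happens in the Poisson subalgebra of the series that commute with all
    the M_j.  Their monomials are balanced ([bal]): alpha_j - beta_j takes the same
    value at j and at -j.  A balanced monomial containing an index contains it, up to
    sign, twice, so that only finitely many indices contribute to a coefficient of a
    bracket, and the identities between brackets can be checked on finitely many
    levels ([eqN], [poisson_box]).

    At the level k the scalar products X = sum |u_j|^2, Y = sum |v_j|^2 and
    W = sum u_j vbar_j over j = k, -k form an sl(2) triple, and distinct levels commute.
    In these terms, with nu = k^2,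
      I_k = A nu X + Y + sum_nu' nu nu' / (nu - nu') (X Y' + X' Y - 2 W W'),
    a family of Uhlenbeck integrals deformed by the function A of sum nu X, and a direct
    computation shows that they commute ([gI_commute]).  Expanding J_k and symmetrizing
    shows that J_k is the sum of the nu^(k-1) I_nu, up to the Casimir elements of the
    triples ([gJE]), and the same with k = 1 gives 2 H + 1 = sum I_nu.  Hence the J_k
    and H commute with the family too.

    The quadratic part of I_k is 2 k (|z_k|^2 + |z_{-k}|^2).  On a balanced monomial
    z^alpha zbar^beta all the corresponding frequencies vanish only if alpha = beta
    ([freq_nonresonant]): the family has only the trivial resonances.  The generator S
    is built one degree at a time: its coefficient at a monomial which is not of the
    form z^alpha zbar^alpha is chosen to remove this monomial from one transformed
    member of the family, picked among those whose frequency does not vanish there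
    ([exp_pick]).  Because the exponential preserves
    commutation ([exp_ad_commute]), the monomial then disappears from every transformed
    series that commutes with the family: at the lowest degree where such a series is
    not normal, its bracket with the picked member reduces to the frequency times the
    unwanted coefficient ([bracket_lowest_defect], [exp_normal]). *)

Set Implicit Arguments.
Unset Strict Implicit.
Unset Printing Implicit Defensive.

Import Order.TTheory GRing.Theory Num.Theory.
Local Open Scope classical_set_scope.
Local Open Scope ring_scope.

(** * Monomials *)

Lemma expoI (a : expo) : injective (+%R^~ a).
Proof.
move=> b c /= bc; apply/expoP => j; have := congr1 (fun x : expo => x j) bc.
by rewrite !expoD => /addIn.
Qed.

Lemma monoI (a : mono) : injective (+%R^~ a).
Proof. by case: a => a1 a2 [b1 b2] [c1 c2] /= [/expoI -> /expoI ->]. Qed.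

Lemma mono1D (m n : mono) j : (m + n).1 j = (m.1 j + n.1 j)%N.
Proof. exact: expoD. Qed.

Lemma mono2D (m n : mono) j : (m + n).2 j = (m.2 j + n.2 j)%N.
Proof. exact: expoD. Qed.

(** Locked, like [mon], [euler], [d] and [pbr] below: unfolding multisets and power
    series during unification is intractable. *)
Definition ev : bool -> idx -> mono :=
  locked (fun b j => if b then (unitv j, 0) else (0, unitv j)).

Lemma evE b j : ev b j = if b then (unitv j, 0) else (0, unitv j).
Proof. by rewrite /ev -lock. Qed.

Definition cnt (b : bool) (j : idx) (m : mono) : nat :=
  if b then m.1 j else m.2 j.

Lemma cntD b j m n : cnt b j (m + n) = (cnt b j m + cnt b j n)%N.
Proof. by case: b; rewrite /cnt ?mono1D ?mono2D. Qed.

Lemma cnt_ev b j c i : cnt b j (ev c i) = (b == c) && (j == i).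
Proof. by rewrite evE; case: b; case: c => /=; rewrite ?unitvE ?expo0. Qed.

Lemma cnt_sub b j m : (0 < cnt b j m)%N -> exists n, m = n + ev b j.
Proof.
have E (a : expo) : (0 < a j)%N -> exists c, a = c + unitv j.
  rewrite -in_mset => ja; exists (a `\ j)%mset.
  by rewrite -[LHS](msetB1K ja) msetDC.
rewrite evE; case: b m => -[m1 m2] /E[c /= ->]; [exists (c, m2) | exists (m1, c)];
  by congr pair; rewrite addr0.
Qed.

Lemma ev_pair j : (unitv j, unitv j) = ev true j + ev false j.
Proof. by rewrite !evE; congr pair; rewrite ?addr0 ?add0r. Qed.

Lemma expo_sum_unitv j : \sum_(i <- supp (unitv j)) unitv j i = 1%N.
Proof.
by rewrite /supp finsupp_msetn /= big_seq_fset1 unitvE eqxx.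
Qed.

Lemma mdeg_ev b j : mdeg (ev b j) = 1%N.
Proof.
have z : (\sum_(i <- supp 0%R) (0%R : expo) i = 0)%N.
  by rewrite big1 // => i _; exact: expo0.
by rewrite evE; case: b; rewrite /mdeg /= z expo_sum_unitv.
Qed.

(** * Derivations of the ring of formal power series *)

Section Derivations.
Variable K : comNzRingType.
Implicit Types F G H : fps K.

Definition mon : mono -> fps K := locked (fun e => FPS (fun m => (m == e)%:R)).

Lemma monE e m : mon e m = (m == e)%:R. Proof. by rewrite /mon -lock. Qed.

Lemma fpsMmonD F e m : (F * mon e) (m + e) = F m.
Proof.
rewrite fpsM -(@fsbig_widen _ _ _ _ [set (m, e)] (decomp (m + e))) /=.
- by rewrite fsbig_set1 /= monE eqxx mulr1.
- by move=> p ->.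
- move=> [x y] /= [xy nxy]; rewrite monE; case: eqVneq => [ye|]; last by rewrite mulr0.
  by case: nxy; move: xy; rewrite /decomp /= ye => /monoI ->.
Qed.

Lemma fpsMmon0 F e m : (forall n, m <> n + e) -> (F * mon e) m = 0.
Proof.
move=> h; rewrite fpsM fsbig1 // => -[x y] /= xy; rewrite monE.
case: eqVneq => [ye|]; last by rewrite mulr0.
by case: (h x); rewrite -ye.
Qed.

Lemma monD e f : mon (e + f) = mon e * mon f.
Proof.
apply/fpsP => m; case: (pselect (exists n, m = n + f)) => [[n ->]|h].
  rewrite fpsMmonD !monE; congr (nat_of_bool _)%:R.
  by apply/eqP/eqP => [/monoI|->].
rewrite fpsMmon0 => [|n mn]; last by apply: h; exists n.
by rewrite monE; case: eqP => // mef; case: h; exists e.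
Qed.

Lemma mon0 : mon 0 = 1.
Proof. by apply/fpsP => m; rewrite monE. Qed.

(** The Euler operator of a variable, multiplying a monomial by the exponent of
    that variable, is visibly a derivation; the partial derivative is obtained
    from it by shifting the monomials, see [d_mon]. *)
Definition euler : bool -> idx -> fps K -> fps K :=
  locked (fun b j F => FPS (fun m => (cnt b j m)%:R * F m)).

Definition d : bool -> idx -> fps K -> fps K :=
  locked (fun b j F => FPS (fun m => (cnt b j m).+1%:R * F (m + ev b j))).

Lemma eulerE b j F m : euler b j F m = (cnt b j m)%:R * F m.
Proof. by rewrite /euler -lock. Qed.

Lemma dE b j F m : d b j F m = (cnt b j m).+1%:R * F (m + ev b j).
Proof. by rewrite /d -lock. Qed.

Lemma eulerM b j F G : euler b j (F * G) = euler b j F * G + F * euler b j G.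
Proof.
apply/fpsP => m; rewrite fpsD eulerE !fpsM !(fsbig_finite _ _ (finite_decomp m)) /=.
rewrite -big_split /= mulr_sumr big_seq [RHS]big_seq; apply: eq_bigr => p.
rewrite in_fset_set ?inE; last exact: finite_decomp.
by move=> /= <-; rewrite !eulerE cntD natrD; ring.
Qed.

Lemma d_mon b j F : d b j F * mon (ev b j) = euler b j F.
Proof.
apply/fpsP => m; case: (pselect (exists n, m = n + ev b j)) => [[n ->]|h].
  by rewrite fpsMmonD dE eulerE cntD cnt_ev !eqxx addn1.
rewrite fpsMmon0 => [|n mn]; last by apply: h; exists n.
have [/cnt_sub //|] := ltnP 0 (cnt b j m).
by rewrite leqn0 eulerE => /eqP ->; rewrite mul0r.
Qed.

Lemma euler_shift b j F m : euler b j F (m + ev b j) = d b j F m.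
Proof. by rewrite -d_mon fpsMmonD. Qed.

Lemma dM b j F G : d b j (F * G) = d b j F * G + F * d b j G.
Proof.
apply/fpsP => m; rewrite -euler_shift eulerM -!d_mon.
by rewrite [_ * _ * G]mulrAC [F * (_ * _)]mulrA -mulrDl fpsMmonD.
Qed.

Lemma dD b j F G : d b j (F + G) = d b j F + d b j G.
Proof. by apply/fpsP => m; rewrite fpsD !dE fpsD mulrDr. Qed.

Lemma dZ b j a F : d b j (a *: F) = a *: d b j F.
Proof. by apply/fpsP => m; rewrite fpsZ !dE fpsZ mulrCA. Qed.

Lemma dC b j c i F : d b j (d c i F) = d c i (d b j F).
Proof.
apply/fpsP => m; rewrite !dE !cntD !cnt_ev [in RHS]addrAC.
rewrite mulrCA !mulrA; congr (_ * _).
rewrite (eq_sym c b) (eq_sym i j).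
case: (eqVneq b c) => [->|_] /=; last by rewrite !addn0 mulrC.
by case: (eqVneq j i) => [->|_]; rewrite ?addn0 mulrC.
Qed.

Lemma d_ev b j c i : d b j (mon (ev c i)) = ((b == c) && (j == i))%:R.
Proof.
apply/fpsP => m; rewrite dE monE.
have [/andP[/eqP -> /eqP ->]|ne] := boolP ((b == c) && (j == i)).
  rewrite fps1 -[X in _ == X]add0r (inj_eq (@monoI _)).
  case: (eqVneq m 0) => [->|]; last by rewrite mulr0.
  by case: c => /=; rewrite expo0 mul1r.
case: (eqVneq (m + ev b j) (ev c i)) => [mi|]; last by rewrite mulr0.
have := congr1 (cnt b j) mi; rewrite cntD !cnt_ev !eqxx (negbTE ne).
by rewrite addn1.
Qed.

Lemma z_E j : z_ j = mon (ev true j) :> fps K.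
Proof. by apply/fpsP => m; rewrite monE evE. Qed.

Lemma zb_E j : zb_ j = mon (ev false j) :> fps K.
Proof. by apply/fpsP => m; rewrite monE evE. Qed.

End Derivations.

(** * Boxes of indices *)

(** The level l = 0, 1, ... gathers the indices l + 1 and -(l + 1), which are [jp l]
    and [jm l]. *)
Definition jp (l : nat) : idx := exist (fun i : int => i != 0) (Posz l.+1) isT.
Definition jm (l : nat) : idx := idx_opp (jp l).

Lemma absj_jp l : absj (jp l) = l.+1. Proof. by []. Qed.
Lemma absj_jm l : absj (jm l) = l.+1. Proof. by rewrite absj_opp. Qed.

Lemma idx_cases j : exists l, j = jp l \/ j = jm l.
Proof.
case: j => -[[|n]|n] j0 //.
  by exists n; left; apply/val_inj.
by exists n; right; apply/val_inj.
Qed.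

Lemma idx_opp_neq j : (idx_opp j == j) = false.
Proof.
apply/eqP => /(congr1 val) /= /eqP; rewrite eq_sym -subr_eq0 opprK -mulr2n.
by rewrite mulrn_eq0 /= (negbTE (valP j)).
Qed.

Definition boxs (N : nat) : seq idx :=
  flatten [seq [:: jp l; jm l] | l <- iota 0 N].

Lemma mem_boxs N j : (j \in boxs N) = (absj j <= N)%N.
Proof.
apply/flatten_mapP/idP => [[l]|].
  rewrite mem_iota add0n => lN; rewrite !inE => /orP[]/eqP ->;
    by rewrite ?absj_jm ?absj_jp.
have [l [->|->]] := idx_cases j; rewrite ?absj_jm ?absj_jp => lN;
  by exists l; rewrite ?mem_iota // !inE eqxx ?orbT.
Qed.

Lemma boxs_uniq N : uniq (boxs N).
Proof.
elim: N => // N IH; rewrite /boxs -addn1 iotaD map_cat flatten_cat cat_uniq IH /=.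
by rewrite -/(boxs N) !mem_boxs absj_jp absj_jm add0n ltnn.
Qed.

Lemma big_boxs (V : nmodType) N (f : idx -> V) :
  \sum_(j <- boxs N) f j = \sum_(l < N) (f (jp l) + f (jm l)).
Proof.
rewrite -(big_mkord xpredT (fun l => f (jp l) + f (jm l))) /boxs /index_iota subn0.
elim: (iota 0 N) => [|l s IH]; first by rewrite !big_nil.
by rewrite /= !big_cons IH addrA.
Qed.

Definition box (N : nat) (m : mono) : Prop :=
  forall b j, (N < absj j)%N -> cnt b j m = 0%N.

Lemma boxD N m n : box N (m + n) -> box N m /\ box N n.
Proof.
move=> h; split=> b j Nj; move: (h b j Nj) => /eqP;
  by rewrite cntD addn_eq0 => /andP[/eqP ? /eqP ?].
Qed.

Lemma box_add N m n : box N m -> box N n -> box N (m + n).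
Proof. by move=> hm hn b j Nj; rewrite cntD hm ?hn. Qed.

Lemma box_ev N b j : (absj j <= N)%N -> box N (ev b j).
Proof.
move=> jN c i Ni; rewrite cnt_ev; case: (eqVneq i j) => [ij|]; last by rewrite andbF.
by move: Ni; rewrite ij ltnNge jN.
Qed.

Lemma boxW N N' m : (N <= N')%N -> box N m -> box N' m.
Proof. by move=> NN h b j Nj; apply: h; apply: leq_ltn_trans Nj. Qed.

Lemma box_exists m : exists N, box N m.
Proof.
pose f (a : expo) := \max_(j <- supp a) absj j.
have E (a : expo) j : (f a < absj j)%N -> a j = 0%N.
  move=> h; apply/eqP; apply: contraLR h => aj; rewrite -leqNgt.
  by apply: leq_bigmax_seq => //; rewrite /supp mem_finsupp.
exists (maxn (f m.1) (f m.2)) => -[] j; rewrite gtn_max => /andP[h1 h2] /=;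
  exact: E.
Qed.

(** Agreement on the monomials in finitely many variables turns the locally finite
    sums and the brackets met here into finite ones. *)
Definition eqN (K : comNzRingType) N (F G : fps K) : Prop :=
  forall m, box N m -> F m = G m.

Lemma eqN_ext (K : comNzRingType) n0 (F G : fps K) :
  (forall N, (n0 <= N)%N -> eqN N F G) -> F = G.
Proof.
move=> h; apply/fpsP => m; have [N Nm] := box_exists m.
apply: (h (maxn n0 N)); first exact: leq_maxl.
by apply: boxW Nm; apply: leq_maxr.
Qed.

Section EqN.
Variables (K : comNzRingType) (N : nat).
Implicit Types F G H : fps K.
Local Notation "F =N G" := (eqN N F G) (at level 70).

Lemma eqN_refl F : F =N F. Proof. by []. Qed.
Lemma eqN_sym F G : F =N G -> G =N F. Proof. by move=> h m /h. Qed.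
Lemma eqN_trans F G H : F =N G -> G =N H -> F =N H.
Proof. by move=> h k m mN; rewrite h ?k. Qed.
Lemma eqN_add F F' G G' : F =N F' -> G =N G' -> F + G =N F' + G'.
Proof. by move=> h k m mN; rewrite !fpsD h ?k. Qed.
Lemma eqN_opp F F' : F =N F' -> - F =N - F'.
Proof. by move=> h m mN; rewrite !fpsN h. Qed.
Lemma eqN_sub F F' G G' : F =N F' -> G =N G' -> F - G =N F' - G'.
Proof. by move=> h k; apply: eqN_add => //; apply: eqN_opp. Qed.
Lemma eqN_scale a F F' : F =N F' -> a *: F =N a *: F'.
Proof. by move=> h m mN; rewrite !fpsZ h. Qed.
Lemma eqN_mul F F' G G' : F =N F' -> G =N G' -> F * G =N F' * G'.
Proof.
move=> h k m mN; rewrite !fpsM; apply: eq_fsbigr => p; rewrite inE => /= pm.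
by move: mN; rewrite -pm => /boxD[p1 p2]; rewrite h ?k.
Qed.
Lemma eqN_sum I (r : seq I) (P : pred I) (f g : I -> fps K) :
  (forall i, P i -> f i =N g i) ->
  \sum_(i <- r | P i) f i =N \sum_(i <- r | P i) g i.
Proof.
move=> h; elim/big_rec2: _ => // i F G Pi FG; apply: eqN_add => //; exact: h.
Qed.

Lemma eqN_d b j F G : (absj j <= N)%N -> F =N G -> d b j F =N d b j G.
Proof.
by move=> jN h m mN; rewrite !dE h //; apply: box_add => //; exact: box_ev.
Qed.

Lemma fps_coef_sum I (r : seq I) (P : pred I) (f : I -> fps K) m :
  (\sum_(i <- r | P i) f i) m = \sum_(i <- r | P i) f i m.
Proof. by elim/big_rec2: _ => // i a F _ <-. Qed.

Lemma eqN_fps_sum (T : choiceType) (A : set T) (f : T -> fps K) (s : seq T) :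
  uniq s -> (forall t, t \in s -> A t) ->
  (forall t, A t -> t \notin s -> f t =N 0) ->
  fps_sum A f =N \sum_(t <- s) f t.
Proof.
move=> us sA f0 m mN; rewrite fps_coef_sum /= (fsbigE s) //.
  by rewrite big_seq_cond [RHS]big_seq; apply: eq_bigl => t;
    case: (boolP (t \in s)) => //= ts; rewrite ?asboolE; apply/mem_set/sA.
by move=> t At /f0 -> //; rewrite inE.
Qed.

Lemma eqN_fps_sumT (f : idx -> fps K) :
  (forall j, (N < absj j)%N -> f j =N 0) ->
  fps_sum [set: idx] f =N \sum_(l < N) (f (jp l) + f (jm l)).
Proof.
move=> f0; rewrite -big_boxs; apply: eqN_fps_sum => //; first exact: boxs_uniq.
by move=> j _; rewrite mem_boxs -ltnNge; apply: f0.
Qed.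

End EqN.

(** * Brackets *)

Section Jacobi.
Variables (A : comNzRingType) (I : Type) (p q : I -> A -> A).
Hypotheses (pD : forall j, {morph p j : x y / x + y})
  (qD : forall j, {morph q j : x y / x + y})
  (pM : forall j x y, p j (x * y) = p j x * y + x * p j y)
  (qM : forall j x y, q j (x * y) = q j x * y + x * q j y)
  (ppC : forall j l x, p j (p l x) = p l (p j x))
  (qqC : forall j l x, q j (q l x) = q l (q j x))
  (qpC : forall j l x, q j (p l x) = p l (q j x)).
Variable s : seq I.

Let b j x y := p j x * q j y - q j x * p j y.
Let br x y := \sum_(j <- s) b j x y.

(** Expanding, each second derivative occurs in two of the three double sums and
    cancels, once the order of the two summation indices in the last sum is chosen
    separately for the second derivatives of x and for those of z. *)
Lemma derivations_jacobi x y z :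
  br x (br y z) = br (br x y) z + br y (br x z).
Proof.
have p0 j : p j 0 = 0 by apply: (addrI (p j 0)); rewrite -pD !addr0.
have q0 j : q j 0 = 0 by apply: (addrI (q j 0)); rewrite -qD !addr0.
have pN j u : p j (- u) = - p j u.
  by apply: (addrI (p j u)); rewrite -pD !subrr.
have qN j u : q j (- u) = - q j u.
  by apply: (addrI (q j u)); rewrite -qD !subrr.
have pbr l u v : p l (br u v) = \sum_(j <- s) p l (b j u v).
  exact: (big_morph _ (@pD l) (p0 l)).
have qbr l u v : q l (br u v) = \sum_(j <- s) q l (b j u v).
  exact: (big_morph _ (@qD l) (q0 l)).
have brE u v : br u v = \sum_(j <- s) (p j u * q j v - q j u * p j v) by [].
have e1 : br x (br y z) = \sum_(j <- s) \sum_(l <- s)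
   (p j x * q j (b l y z) - q j x * p j (b l y z)).
  rewrite brE; apply: eq_bigr => j _; rewrite pbr qbr.
  by rewrite mulr_sumr [X in _ - X]mulr_sumr -sumrB.
have e2 : br (br x y) z = \sum_(j <- s) \sum_(l <- s)
   (p l (b j x y) * q l z - q l (b j x y) * p l z).
  rewrite brE exchange_big; apply: eq_bigr => j _; rewrite pbr qbr.
  by rewrite mulr_suml [X in _ - X]mulr_suml -sumrB.
have e3 : br y (br x z) = \sum_(j <- s) \sum_(l <- s)
   ((p l y * (p j x * q l (q j z) - q j x * q l (p j z))
     - q l y * (p j x * p l (q j z) - q j x * p l (p j z)))
   + (p j y * (q j (p l x) * q l z - q j (q l x) * p l z)
     - q j y * (p j (p l x) * q l z - p j (q l x) * p l z))).
  under [RHS]eq_bigr => j _ do rewrite big_split /=.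
  rewrite big_split /= [X in _ = X + _]exchange_big /= -big_split /=.
  rewrite brE; apply: eq_bigr => j _; rewrite pbr qbr.
  rewrite mulr_sumr [X in _ - X]mulr_sumr -sumrB -big_split /=.
  by apply: eq_bigr => l _; rewrite /b !(pD, qD, pN, qN) !(pM, qM); ring.
rewrite e1 e2 e3 -big_split; apply: eq_bigr => j _ /=.
rewrite -big_split; apply: eq_bigr => l _ /=.
rewrite /b !(pD, qD, pN, qN) !(pM, qM) !qpC !(qqC l j) !(ppC l j).
ring.
Qed.

End Jacobi.


Section Bracket.
Variable R : realType.
Local Notation C := R[i].
Implicit Types F G H S : fps C.

Definition pb (j : idx) F G : fps C :=
  d true j F * d false j G - d false j F * d true j G.

Definition pbr : seq idx -> fps C -> fps C -> fps C :=
  locked (fun s F G => 'i *: \sum_(j <- s) pb j F G).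

Lemma pbrE s F G : pbr s F G = 'i *: \sum_(j <- s) pb j F G.
Proof. by rewrite /pbr -lock. Qed.

Lemma poissonE F G m : poisson F G m = 'i * \sum_(j \in [set: idx]) pb j F G m.
Proof.
rewrite [LHS]/=; congr (_ * _); apply: eq_fsbigr => j _.
have E b c : (d b j F * d c j G) m =
    (euler b j F * euler c j G) (m + ev b j + ev c j).
  rewrite -!d_mon; move: (d b j F) (d c j G) => X Y.
  rewrite (_ : X * _ * _ = X * Y * mon C (ev b j) * mon C (ev c j)); last by ring.
  by rewrite fpsMmonD fpsMmonD.
rewrite /pb fpsD fpsN (E true false) (E false true) -!addrA [ev false j + _]addrC.
rewrite -ev_pair !fpsM.
set e := m + _.
move: (decomp e) (finite_decomp e) => D finD.
rewrite [LHS](fsbig_finite _ _ finD) [X in _ = X - _](fsbig_finite _ _ finD).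
rewrite [X in _ = _ - X](fsbig_finite _ _ finD) -sumrB /=.
by apply: eq_bigr => p _; rewrite !eulerE !natrM /=; ring.
Qed.

Section FiniteBracket.
Variable s : seq idx.

Lemma pbrC F G : pbr s F G = - pbr s G F.
Proof.
rewrite !pbrE -scalerN -sumrN; congr (_ *: _); apply: eq_bigr => j _.
by rewrite /pb; ring.
Qed.

Lemma pbrDr F G H : pbr s F (G + H) = pbr s F G + pbr s F H.
Proof.
rewrite !pbrE -scalerDr -big_split; congr (_ *: _); apply: eq_bigr => j _.
by rewrite /pb !dD /=; ring.
Qed.

Lemma pbrZr a F G : pbr s F (a *: G) = a *: pbr s F G.
Proof.
rewrite !pbrE scalerA [a * _]mulrC -scalerA; congr (_ *: _); rewrite scaler_sumr.
by apply: eq_bigr => j _; rewrite /pb !dZ -!scalerAr scalerBr.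
Qed.

Lemma pbrMr F G H : pbr s F (G * H) = pbr s F G * H + G * pbr s F H.
Proof.
rewrite !pbrE -scalerAl -scalerAr -scalerDr mulr_suml mulr_sumr -big_split.
by congr (_ *: _); apply: eq_bigr => j _; rewrite /pb !dM /=; ring.
Qed.

Lemma pbr_jacobi F G H :
  pbr s F (pbr s G H) = pbr s (pbr s F G) H + pbr s G (pbr s F H).
Proof.
pose br X Y := \sum_(j <- s) pb j X Y.
have E X Y : pbr s X Y = 'i *: br X Y by exact: pbrE.
have Zr a X Y : br X (a *: Y) = a *: br X Y.
  rewrite scaler_sumr; apply: eq_bigr => j _.
  by rewrite /pb !dZ -!scalerAr scalerBr.
have Zl a X Y : br (a *: X) Y = a *: br X Y.
  rewrite scaler_sumr; apply: eq_bigr => j _.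
  by rewrite /pb !dZ -!scalerAl scalerBr.
have J : br F (br G H) = br (br F G) H + br G (br F H).
  apply: (@derivations_jacobi _ _ (d true) (d false));
  [exact: dD | exact: dD | exact: dM | exact: dM | move=> *; exact: dC ..].
by clearbody br; rewrite !E !Zr !Zl -!scalerDr J.
Qed.

End FiniteBracket.
End Bracket.

(** * Balanced series *)

(** A monomial is balanced when it Poisson commutes with every
    |z_j|^2 - |z_{-j}|^2, that is, with all the M_j. *)
Definition bal (m : mono) : Prop :=
  forall j, (m.1 j + m.2 (idx_opp j) = m.2 j + m.1 (idx_opp j))%N.

Definition balanced (K : comNzRingType) (F : fps K) : Prop :=
  forall m, ~ bal m -> F m = 0.

Lemma bal_add m n : bal m -> bal n -> bal (m + n).
Proof.
move=> hm hn j; move: (hm j) (hn j); rewrite !mono1D !mono2D; lia.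
Qed.

Lemma bal_cancel m n : bal (m + n) -> bal n -> bal m.
Proof.
move=> hm hn j; move: (hm j) (hn j); rewrite !mono1D !mono2D; lia.
Qed.

Lemma bal0 : bal 0.
Proof. by move=> j; rewrite /= !expo0. Qed.

Lemma bal_pair j : bal (unitv j, unitv j).
Proof. by move=> i /=; rewrite addnC. Qed.

Section Balanced.
Variable K : comNzRingType.
Implicit Types F G : fps K.

Lemma balanced0 : balanced (0 : fps K). Proof. by []. Qed.

Lemma balanced1 : balanced (1 : fps K).
Proof. by move=> m bm; rewrite fps1; case: eqP => // m0; case: bm; rewrite m0; exact: bal0. Qed.

Lemma balancedD F G : balanced F -> balanced G -> balanced (F + G).
Proof. by move=> f g m bm; rewrite fpsD f // g // addr0. Qed.

Lemma balancedN F : balanced F -> balanced (- F).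
Proof. by move=> f m bm; rewrite fpsN f // oppr0. Qed.

Lemma balancedB F G : balanced F -> balanced G -> balanced (F - G).
Proof. by move=> f g; apply: balancedD => //; apply: balancedN. Qed.

Lemma balancedZ a F : balanced F -> balanced (a *: F).
Proof. by move=> f m bm; rewrite fpsZ f // mulr0. Qed.

Lemma balanced_sum I (r : seq I) (P : pred I) (f : I -> fps K) :
  (forall i, P i -> balanced (f i)) -> balanced (\sum_(i <- r | P i) f i).
Proof. by move=> h m bm; rewrite fps_coef_sum big1 // => i /h ->. Qed.

Lemma balanced_fps_sum (T : choiceType) (A : set T) (f : T -> fps K) :
  (forall t, A t -> balanced (f t)) -> balanced (fps_sum A f).
Proof. by move=> h m bm /=; rewrite fsbig1 // => t /h ->. Qed.

Lemma balancedM F G : balanced F -> balanced G -> balanced (F * G).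
Proof.
move=> f g m bm; rewrite fpsM fsbig1 // => p pm.
have [b1|b1] := pselect (bal p.1); last by rewrite f ?mul0r.
have [b2|b2] := pselect (bal p.2); last by rewrite g ?mulr0.
by case: bm; rewrite -[m]pm; apply: bal_add.
Qed.

Lemma balanced_mon e : bal e -> balanced (mon K e).
Proof. by move=> be m bm; rewrite monE; case: eqP => // me; case: bm; rewrite me. Qed.

(** In a balanced monomial a factor of index j comes with a further one of index j or
    -j, which survives the derivation. *)
Lemma dM_out N b j F G m : balanced F -> box N m -> (N < absj j)%N ->
  (d b j F * G) m = 0.
Proof.
move=> f mN Nj; rewrite fpsM fsbig1 // => p pm; rewrite dE f ?mulr0 ?mul0r //.
have [p1 _] : box N p.1 /\ box N p.2 by apply: boxD; rewrite [_ + _]pm.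
move=> /(_ j); rewrite !mono1D !mono2D.
have Z c i : (N < absj i)%N -> cnt c i p.1 = 0%N by apply: p1.
move: (Z true j Nj) (Z false j Nj) => /= -> ->.
have Noj : (N < absj (idx_opp j))%N by rewrite absj_opp.
move: (Z true _ Noj) (Z false _ Noj) => /= -> ->.
have noj : (j == idx_opp j) = false by rewrite eq_sym idx_opp_neq.
by rewrite evE; case: b => /=; rewrite !unitvE ?expo0 ?eqxx ?idx_opp_neq ?noj.
Qed.

Lemma balanced_eqN n0 F :
  (forall N, (n0 <= N)%N -> exists2 G, eqN N F G & balanced G) -> balanced F.
Proof.
move=> h m bm; have [N mN] := box_exists m.
have [G FG bG] := h _ (leq_maxl n0 N).
by rewrite FG ?bG //; apply: boxW mN; apply: leq_maxr.
Qed.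

(** * Order of vanishing *)

Definition vord (n : nat) F : Prop := forall m, (mdeg m < n)%N -> F m = 0.

Lemma vord0 F : vord 0 F. Proof. by []. Qed.

Lemma vordW n k F : (n <= k)%N -> vord k F -> vord n F.
Proof. by move=> nk h m mn; apply: h; apply: leq_trans nk. Qed.

Lemma vordD n F G : vord n F -> vord n G -> vord n (F + G).
Proof. by move=> f g m mn; rewrite fpsD f // g // addr0. Qed.

Lemma vordN n F : vord n F -> vord n (- F).
Proof. by move=> f m mn; rewrite fpsN f // oppr0. Qed.

Lemma vordB n F G : vord n F -> vord n G -> vord n (F - G).
Proof. by move=> f g; apply: vordD => //; apply: vordN. Qed.

Lemma vordZ n a F : vord n F -> vord n (a *: F).
Proof. by move=> f m mn; rewrite fpsZ f // mulr0. Qed.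

Lemma vord_sum n I (r : seq I) (P : pred I) (f : I -> fps K) :
  (forall i, P i -> vord n (f i)) -> vord n (\sum_(i <- r | P i) f i).
Proof. by move=> h m mn; rewrite fps_coef_sum big1 // => i /h ->. Qed.

Lemma vordM n k F G : vord n F -> vord k G -> vord (n + k) (F * G).
Proof.
move=> f g m mnk; rewrite fpsM fsbig1 // => p pm.
have := mdegD p.1 p.2; rewrite [_ + _]pm => mE.
have [pn|pn] := ltnP (mdeg p.1) n; first by rewrite f // mul0r.
by rewrite g ?mulr0 //; move: mnk; rewrite mE; lia.
Qed.

Lemma vord_mon e : vord (mdeg e) (mon K e).
Proof. by move=> m; rewrite monE; case: eqP => // ->; rewrite ltnn. Qed.

End Balanced.

(** * The bracket of balanced series *)

Section PoissonBalanced.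
Variable R : realType.
Local Notation C := R[i].
Implicit Types F G H S : fps C.

(** By [dM_out] the indices outside the box do not contribute.  All properties of the
    bracket of balanced series follow from those of the finite bracket [pbr]. *)
Lemma poisson_box N F G : balanced F ->
  eqN N (poisson F G) (pbr (boxs N) F G).
Proof.
move=> f m mN; rewrite poissonE pbrE fpsZ fps_coef_sum; congr (_ * _).
rewrite (fsbigE (boxs N)) ?boxs_uniq //.
  by apply: eq_bigl => j; rewrite in_setT.
move=> j _; rewrite mem_boxs -ltnNge => Nj.
by rewrite /pb fpsD fpsN !(dM_out _ _ f mN Nj) subr0.
Qed.

Lemma eqN_pbr N F F' G G' : eqN N F F' -> eqN N G G' ->
  eqN N (pbr (boxs N) F G) (pbr (boxs N) F' G').
Proof.
move=> h k; rewrite !pbrE; apply: eqN_scale.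
rewrite [X in eqN _ X _]big_seq [X in eqN _ _ X]big_seq.
by apply: eqN_sum => j; rewrite mem_boxs => jN;
  apply: eqN_sub; apply: eqN_mul; apply: eqN_d.
Qed.

Lemma poisson_balanced F G : balanced F -> balanced G -> balanced (poisson F G).
Proof.
move=> f g m bm; rewrite [LHS]/= fsbig1 ?mulr0 // => j _; rewrite fsbig1 // => p pm.
have [b1|b1] := pselect (bal p.1); last by rewrite f ?mul0r.
have [b2|b2] := pselect (bal p.2); last by rewrite g ?mulr0 ?mul0r.
case: bm; apply: (@bal_cancel _ (unitv j, unitv j)); last exact: bal_pair.
by rewrite -[X in bal X]pm; apply: bal_add.
Qed.

Lemma poisson_vord n k l F G : vord n F -> vord k G -> (l + 2 <= n + k)%N ->
  vord l (poisson F G).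
Proof.
move=> f g lnk m ml; rewrite [LHS]/= fsbig1 ?mulr0 // => j _.
rewrite fsbig1 // => -[x y] xy /=.
have [xn|xn] := ltnP (mdeg x) n; first by rewrite f // !mul0r.
rewrite g ?mulr0 ?mul0r //.
have := mdegD x y; rewrite [x + y]xy ev_pair !mdegD !mdeg_ev; lia.
Qed.

Lemma poissonC F G : balanced F -> balanced G -> poisson F G = - poisson G F.
Proof.
move=> f g; apply: (@eqN_ext _ 0) => N _.
apply: eqN_trans (poisson_box _ f) _; rewrite pbrC.
by apply/eqN_opp/eqN_sym/poisson_box.
Qed.

Lemma poissonDr F G H : balanced F ->
  poisson F (G + H) = poisson F G + poisson F H.
Proof.
move=> f; apply: (@eqN_ext _ 0) => N _.
apply: eqN_trans (poisson_box _ f) _; rewrite pbrDr.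
by apply: eqN_add; apply/eqN_sym/poisson_box.
Qed.

Lemma poissonZr a F G : balanced F -> poisson F (a *: G) = a *: poisson F G.
Proof.
move=> f; apply: (@eqN_ext _ 0) => N _.
apply: eqN_trans (poisson_box _ f) _; rewrite pbrZr.
by apply: eqN_scale; apply/eqN_sym/poisson_box.
Qed.

Lemma poissonNr F G : balanced F -> poisson F (- G) = - poisson F G.
Proof. by move=> f; rewrite -scaleN1r poissonZr // scaleN1r. Qed.

Lemma poissonBr F G H : balanced F ->
  poisson F (G - H) = poisson F G - poisson F H.
Proof. by move=> f; rewrite poissonDr // poissonNr. Qed.

Lemma poisson0r F : balanced F -> poisson F 0 = 0.
Proof. by move=> f; rewrite -(scale0r 0) poissonZr // !scale0r. Qed.

Lemma poisson_sumr F I (r : seq I) (P : pred I) (f : I -> fps C) : balanced F ->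
  poisson F (\sum_(i <- r | P i) f i) = \sum_(i <- r | P i) poisson F (f i).
Proof.
by move=> bF; apply: (big_morph _ (fun G H => poissonDr G H bF) (poisson0r bF)).
Qed.

Lemma poissonDl F G H : balanced F -> balanced G -> balanced H ->
  poisson (F + G) H = poisson F H + poisson G H.
Proof.
move=> f g h; rewrite poissonC ?poissonDr //; last exact: balancedD.
by rewrite opprD -!poissonC.
Qed.

Lemma poissonZl a F G : balanced F -> balanced G ->
  poisson (a *: F) G = a *: poisson F G.
Proof.
move=> f g; rewrite poissonC ?poissonZr //; last exact: balancedZ.
by rewrite -scalerN -poissonC.
Qed.

Lemma poisson_suml G I (r : seq I) (P : pred I) (f : I -> fps C) : balanced G ->
  (forall i, balanced (f i)) ->
  poisson (\sum_(i <- r | P i) f i) G = \sum_(i <- r | P i) poisson (f i) G.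
Proof.
move=> g bf; rewrite poissonC //; last by apply: balanced_sum => i _.
by rewrite poisson_sumr // -sumrN; apply: eq_bigr => i _; rewrite -poissonC.
Qed.

Lemma poisson_jacobi F G H : balanced F -> balanced G -> balanced H ->
  poisson F (poisson G H) = poisson (poisson F G) H + poisson G (poisson F H).
Proof.
move=> f g h; apply: (@eqN_ext _ 0) => N _.
apply: eqN_trans (poisson_box _ f) _.
apply: eqN_trans (eqN_pbr (@eqN_refl _ _ _) (poisson_box _ g)) _.
rewrite pbr_jacobi; apply: eqN_add; apply: eqN_sym.
  apply: eqN_trans (poisson_box _ (poisson_balanced f g)) _.
  exact: eqN_pbr (poisson_box _ f) (@eqN_refl _ _ _).
apply: eqN_trans (poisson_box _ g) _.
exact: eqN_pbr (@eqN_refl _ _ _) (poisson_box _ f).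
Qed.

(** * Real series *)

Definition real_fps F : Prop := forall a b : expo, F (a, b) = (F (b, a))^*.

Lemma real_fpsP F : real_fps F <-> fps_conj F = F.
Proof.
split=> [h|h a b]; last by rewrite -[F in LHS]h.
by apply/fpsP => -[a b]; rewrite [RHS]h.
Qed.

Lemma fps_conjD F G : fps_conj (F + G) = fps_conj F + fps_conj G.
Proof. by apply/fpsP => m /=; rewrite rmorphD. Qed.

Lemma fps_conjN F : fps_conj (- F) = - fps_conj F.
Proof. by apply/fpsP => m /=; rewrite rmorphN. Qed.

Lemma fps_conjB F G : fps_conj (F - G) = fps_conj F - fps_conj G.
Proof. by rewrite fps_conjD fps_conjN. Qed.

Lemma fps_conjZ a F : fps_conj (a *: F) = a^* *: fps_conj F.
Proof. by apply/fpsP => m /=; rewrite rmorphM. Qed.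

Lemma fps_conj0 : fps_conj (0 : fps C) = 0.
Proof. by apply/fpsP => m /=; rewrite rmorph0. Qed.

Lemma fps_conj1 : fps_conj (1 : fps C) = 1.
Proof. by apply/fpsP => -[a b] /=; rewrite conjC_nat !xpair_eqE andbC. Qed.

Lemma fps_conj_sum I (r : seq I) (P : pred I) (f : I -> fps C) :
  fps_conj (\sum_(i <- r | P i) f i) = \sum_(i <- r | P i) fps_conj (f i).
Proof. exact: (big_morph _ fps_conjD fps_conj0). Qed.

Lemma fps_conjM F G : fps_conj (F * G) = fps_conj F * fps_conj G.
Proof.
apply/fpsP => m; rewrite fpsM [LHS]/=.
pose sw (p : mono * mono) : mono * mono := ((p.1.2, p.1.1), (p.2.2, p.2.1)).
rewrite (reindex_fsbig sw (decomp m)) /=; last first.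
  split.
  - by move=> -[[a b] [c e]] /= <-.
  - by move=> -[[a b] [c e]] [[a' b'] [c' e']] _ _ [-> -> -> ->].
  - by move=> -[[a b] [c e]] /= abce; exists ((b, a), (e, c)) => //;
      case: m abce => m1 m2 [<- <-].
rewrite !(fsbig_finite _ _ (finite_decomp m)) /= rmorph_sum.
by apply: eq_bigr => p _; rewrite rmorphM.
Qed.

Lemma fps_conj_d b j F : fps_conj (d b j F) = d (~~ b) j (fps_conj F).
Proof.
have E H n : fps_conj H n = (H (n.2, n.1))^* by [].
apply/fpsP => -[m1 m2]; rewrite dE !E dE rmorphM /= conjC_nat !evE.
by case: b.
Qed.

Lemma eqN_conj N F G : eqN N F G -> eqN N (fps_conj F) (fps_conj G).
Proof.
move=> h m mN; rewrite [LHS]/= [RHS]/= h // => b j /(mN (~~ b)).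
by case: b.
Qed.

Lemma conj_pbr s F G : fps_conj (pbr s F G) = pbr s (fps_conj F) (fps_conj G).
Proof.
rewrite !pbrE fps_conjZ conjCi scaleNr -scalerN fps_conj_sum -sumrN; congr (_ *: _).
apply: eq_bigr => j _; rewrite /pb fps_conjB !fps_conjM !fps_conj_d /=; ring.
Qed.

Lemma real_fps_eqN n0 F :
  (forall N, (n0 <= N)%N -> exists2 G, eqN N F G & real_fps G) -> real_fps F.
Proof.
move=> h; apply/real_fpsP/(@eqN_ext _ n0) => N nN; have [G FG /real_fpsP rG] := h N nN.
apply: eqN_trans (eqN_conj FG) _; rewrite rG; exact: eqN_sym.
Qed.

Lemma poisson_real F G : balanced F -> real_fps F -> real_fps G ->
  real_fps (poisson F G).
Proof.
move=> f /real_fpsP rF /real_fpsP rG; apply: (@real_fps_eqN 0) => N _.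
exists (pbr (boxs N) F G); first exact: poisson_box.
by apply/real_fpsP; rewrite conj_pbr rF rG.
Qed.

Lemma real_fpsD F G : real_fps F -> real_fps G -> real_fps (F + G).
Proof. by move=> /real_fpsP f /real_fpsP g; apply/real_fpsP; rewrite fps_conjD f g. Qed.

Lemma real_fpsN F : real_fps F -> real_fps (- F).
Proof. by move=> /real_fpsP f; apply/real_fpsP; rewrite fps_conjN f. Qed.

Lemma real_fpsM F G : real_fps F -> real_fps G -> real_fps (F * G).
Proof. by move=> /real_fpsP f /real_fpsP g; apply/real_fpsP; rewrite fps_conjM f g. Qed.

Lemma real_fpsZ a F : a^* = a -> real_fps F -> real_fps (a *: F).
Proof. by move=> ra /real_fpsP f; apply/real_fpsP; rewrite fps_conjZ ra f. Qed.

Lemma real_fps1 : real_fps (1 : fps C).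
Proof. by apply/real_fpsP/fps_conj1. Qed.

Lemma real_fps_sum I (r : seq I) (P : pred I) (f : I -> fps C) :
  (forall i, P i -> real_fps (f i)) -> real_fps (\sum_(i <- r | P i) f i).
Proof.
move=> h; apply/real_fpsP; rewrite fps_conj_sum; apply: eq_bigr => i Pi.
by apply/real_fpsP/h.
Qed.

End PoissonBalanced.

(** * A family of commuting quadratic forms in sl(2) triples *)

Section Gaudin.
Variables (A : comNzRingType) (br : A -> A -> A).
Hypotheses (br_alt : forall u, br u u = 0)
  (brC : forall u v, br u v = - br v u)
  (brD : forall u, {morph br u : v t / v + t})
  (brM : forall u v t, br u (v * t) = br u v * t + v * br u t).
Variables (I : finType) (x y w nu : I -> A) (c : I -> I -> A) (a : A).
Hypotheses (xx : forall k l, br (x k) (x l) = 0)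
  (yy : forall k l, br (y k) (y l) = 0)
  (ww : forall k l, br (w k) (w l) = 0)
  (xy : forall k l, br (x k) (y l) = - 4 * w k *+ (k == l))
  (xw : forall k l, br (x k) (w l) = - 2 * x k *+ (k == l))
  (yw : forall k l, br (y k) (w l) = 2 * y k *+ (k == l))
  (bnu : forall u k, br u (nu k) = 0)
  (bc : forall u k l, br u (c k l) = 0)
  (cC : forall k l, c k l = - c l k)
  (cnu : forall k l, k != l -> c k l * (nu k - nu l) = nu k * nu l)
  (c3 : forall k l s, k != l -> k != s -> l != s ->
     c k l * c l s + c k s * c l k = c k s * c l s)
  (aV : a * (1 + \sum_l nu l * x l) = 1).

(** When x, y, w are the scalar products |q|^2, |p|^2, q.p of canonical vectors at each
    level, this is the sum of the squared angular momenta between two levels. *)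
Definition gL k l := x k * y l + x l * y k - 2 * (w k * w l).

Definition gI k :=
  nu k * (a * x k) + y k + \sum_(s | s != k) c k s * gL k s.

Let br0 u : br u 0 = 0.
Proof. by apply: (addrI (br u 0)); rewrite -brD !addr0. Qed.

Let brN u v : br u (- v) = - br u v.
Proof. by apply: (addrI (br u v)); rewrite -brD !subrr br0. Qed.

Let br1 u : br u 1 = 0.
Proof. by apply: (addrI (br u 1)); rewrite -{3}[1]mulr1 brM mulr1 mul1r addr0. Qed.

Let br_sum u (P : pred I) (f : I -> A) :
  br u (\sum_(s | P s) f s) = \sum_(s | P s) br u (f s).
Proof. exact: (big_morph _ (@brD u) (br0 u)). Qed.

Let br2 u : br u 2 = 0.
Proof. by rewrite -[2]/(1 + 1 : A) brD br1 addr0. Qed.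

Let br_a u : br u a = - a ^+ 2 * \sum_s nu s * br u (x s).
Proof.
set D := \sum_s _.
have E : br u a * (1 + \sum_s nu s * x s) + a * D = 0.
  have := brM u a (1 + \sum_s nu s * x s); rewrite aV br1 => h.
  rewrite [RHS]h; congr (_ + _ * _); rewrite brD br1 add0r br_sum /D; apply: eq_bigr => s _.
  by rewrite brM bnu mul0r add0r.
have -> : br u a = a * (1 + \sum_s nu s * x s) * br u a by rewrite aV mul1r.
rewrite -mulrA [_ * br u a]mulrC.
by move/eqP: E; rewrite addr_eq0 => /eqP ->; ring.
Qed.

Let br_gL u k s : br u (gL k s) =
  br u (x k) * y s + x k * br u (y s) + br u (x s) * y k + x s * br u (y k)
  - 2 * (br u (w k) * w s + w k * br u (w s)).
Proof. by rewrite /gL brD brN brD !brM br2; ring. Qed.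

Let br_gI u k : br u (gI k) =
  nu k * (br u a * x k + a * br u (x k)) + br u (y k) +
  \sum_(s | s != k) c k s * br u (gL k s).
Proof.
rewrite /gI 2!brD br_sum !brM bnu mul0r add0r; congr (_ + _).
by apply: eq_bigr => s _; rewrite brM bc mul0r add0r.
Qed.

Let yx k l : br (y k) (x l) = 4 * w k *+ (k == l).
Proof.
by rewrite brC xy eq_sym; case: eqP => [->|_]; rewrite ?mulr1n ?mulr0n; ring.
Qed.

Let wx k l : br (w k) (x l) = 2 * x k *+ (k == l).
Proof.
by rewrite brC xw eq_sym; case: eqP => [->|_]; rewrite ?mulr1n ?mulr0n; ring.
Qed.

Let wy k l : br (w k) (y l) = - 2 * y k *+ (k == l).
Proof.
by rewrite brC yw eq_sym; case: eqP => [->|_]; rewrite ?mulr1n ?mulr0n; ring.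
Qed.

Let xa k : br (x k) a = 0.
Proof. by rewrite br_a big1 ?mulr0 // => s _; rewrite xx mulr0. Qed.

Let ya k : br (y k) a = - 4 * a ^+ 2 * nu k * w k.
Proof.
rewrite br_a (bigD1 k) //= big1 => [|s sk].
  by rewrite yx eqxx mulr1n; ring.
by rewrite yx eq_sym (negbTE sk) mulr0.
Qed.

Let wa k : br (w k) a = - 2 * a ^+ 2 * nu k * x k.
Proof.
rewrite br_a (bigD1 k) //= big1 => [|s sk].
  by rewrite wx eqxx mulr1n; ring.
by rewrite wx eq_sym (negbTE sk) mulr0.
Qed.

Let bE := (xx, yy, ww, xy, xw, yw, yx, wx, wy, xa, ya, wa).

(* The bracket of the sl(2) triple at s with the member l of the family: only the
   summand joining s and l contributes when s differs from l. *)
Let other u l s : s != l ->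
  (forall t, t != s -> [/\ br u (x t) = 0, br u (y t) = 0 & br u (w t) = 0]) ->
  br u (gI l) = nu l * (br u a * x l) +
    c l s * (x l * br u (y s) + br u (x s) * y l - 2 * (w l * br u (w s))).
Proof.
move=> sl h; rewrite eq_sym in sl; have [hx hy hw] := h l sl.
rewrite br_gI hx hy mulr0 !addr0 (bigD1 s) ?big1 /=; last first.
- by rewrite eq_sym.
- move=> t /andP[tl ts]; have [tx ty tw] := h t ts.
  by rewrite br_gL hx hy hw tx ty tw; ring.
by rewrite br_gL hx hy hw; ring.
Qed.

Let same u l :
  (forall t, t != l -> [/\ br u (x t) = 0, br u (y t) = 0 & br u (w t) = 0]) ->
  br u (gI l) = nu l * (br u a * x l + a * br u (x l)) + br u (y l) +
    \sum_(s | s != l) c l s *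
      (br u (x l) * y s + x s * br u (y l) - 2 * (br u (w l) * w s)).
Proof.
move=> h; rewrite br_gI; congr (_ + _); apply: eq_bigr => s sl.
by have [hx hy hw] := h s sl; rewrite br_gL hx hy hw; ring.
Qed.

Let offx k t : t != k ->
  [/\ br (x k) (x t) = 0, br (x k) (y t) = 0 & br (x k) (w t) = 0].
Proof. by move=> /negbTE tk; rewrite !bE eq_sym tk. Qed.

Let offy k t : t != k ->
  [/\ br (y k) (x t) = 0, br (y k) (y t) = 0 & br (y k) (w t) = 0].
Proof. by move=> /negbTE tk; rewrite !bE eq_sym tk. Qed.

Let offw k t : t != k ->
  [/\ br (w k) (x t) = 0, br (w k) (y t) = 0 & br (w k) (w t) = 0].
Proof. by move=> /negbTE tk; rewrite !bE eq_sym tk. Qed.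

Let Ix l s : s != l ->
  br (gI l) (x s) = 4 * c l s * (x l * w s - w l * x s).
Proof.
by move=> sl; rewrite brC (other sl (@offx s)) !bE eqxx ?mulr1n; ring.
Qed.

Let Iy l s : s != l -> br (gI l) (y s) =
  4 * a ^+ 2 * nu l * nu s * x l * w s - 4 * c l s * (y l * w s - w l * y s).
Proof.
by move=> sl; rewrite brC (other sl (@offy s)) !bE eqxx ?mulr1n; ring.
Qed.

Let Iw l s : s != l -> br (gI l) (w s) =
  2 * a ^+ 2 * nu l * nu s * x l * x s - 2 * c l s * (y l * x s - y s * x l).
Proof.
by move=> sl; rewrite brC (other sl (@offw s)) !bE eqxx ?mulr1n; ring.
Qed.

Let Ixl l : br (gI l) (x l) =
  4 * w l + \sum_(s | s != l) 4 * c l s * (x s * w l - w s * x l).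
Proof.
rewrite brC (same (@offx l)) !bE eqxx ?mulr1n opprD -sumrN; congr (_ + _).
  by ring.
by apply: eq_bigr => s _; ring.
Qed.

Let Iyl l : br (gI l) (y l) =
  4 * a ^+ 2 * nu l ^+ 2 * w l * x l - 4 * nu l * a * w l
  + \sum_(s | s != l) 4 * c l s * (w s * y l - w l * y s).
Proof.
rewrite brC (same (@offy l)) !bE eqxx ?mulr1n opprD -sumrN; congr (_ + _).
  by ring.
by apply: eq_bigr => s _; ring.
Qed.

Let Iwl l : br (gI l) (w l) =
  2 * a ^+ 2 * nu l ^+ 2 * x l ^+ 2 - 2 * nu l * a * x l + 2 * y l
  + \sum_(s | s != l) 2 * c l s * (x s * y l - x l * y s).
Proof.
rewrite brC (same (@offw l)) !bE eqxx ?mulr1n opprD -sumrN; congr (_ + _).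
  by ring.
by apply: eq_bigr => s _; ring.
Qed.

Let Ia l : br (gI l) a =
  4 * a ^+ 2 * nu l * x l * (\sum_s nu s * w s) - 4 * a * nu l * w l.
Proof.
have E : \sum_s nu s * br (gI l) (x s) = 4 * nu l *
    (w l * (1 + \sum_s nu s * x s) - x l * \sum_s nu s * w s).
  rewrite (bigD1 l) //= Ixl [\sum_s nu s * x s](bigD1 l) //=.
  rewrite [\sum_s nu s * w s](bigD1 l) //= mulrDr -addrA mulr_sumr -big_split /=.
  transitivity (4 * nu l * w l + \sum_(s | s != l)
      (4 * nu l * w l * (nu s * x s) - 4 * nu l * x l * (nu s * w s))).
    congr (_ + _); first by ring.
    apply: eq_bigr => s sl; rewrite Ix //.
    rewrite eq_sym in sl; have e := cnu sl.
    transitivity (4 * (x s * w l - w s * x l) * (c l s * (nu l - nu s))).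
      by ring.
    by rewrite e; ring.
  by rewrite sumrB -!mulr_sumr; ring.
rewrite br_a E; move: (\sum_s _) aV => D aD.
transitivity (4 * a ^+ 2 * nu l * x l * (\sum_s nu s * w s)
   - 4 * a * nu l * w l * (a * (1 + D))); first by ring.
by rewrite aD; ring.
Qed.

(** The brackets of I_l with x, y, w and a are listed above; inserting them, each third
    level s contributes a part free of a, which vanishes by [c3] (an identity between
    the inverses of differences of the 1 / nu), and a part in a^2, which joins the
    contribution of k and l by a (1 + sum nu x) = 1. *)
Theorem gI_commute k l : k != l -> br (gI k) (gI l) = 0.
Proof.
move=> kl; rewrite brC; apply/eqP; rewrite oppr_eq0; apply/eqP.
have lk : l != k by rewrite eq_sym.
rewrite br_gI (bigD1 l) //= (Ix kl) (Iy kl) Ia.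
under eq_bigr => s /andP[sk sl].
  rewrite br_gL (Ix sl) (Iy sl) (Iw sl) (Ix kl) (Iy kl) (Iw kl).
  over.
rewrite br_gL Ixl Iyl Iwl (Ix kl) (Iy kl) (Iw kl).
rewrite ![\sum_(s | s != l) _](bigD1 k) //=.
under [\sum_(i | (i != l) && (i != k)) 4 * c l i * (w i * y l - w l * y i)]eq_bigl
  => i do rewrite andbC.
under [\sum_(i | (i != l) && (i != k)) 4 * c l i * (x i * w l - w i * x l)]eq_bigl
  => i do rewrite andbC.
under [\sum_(i | (i != l) && (i != k)) _]eq_bigl => i do rewrite andbC.
move: aV; rewrite ![\sum_s _](bigD1 k) //= ![\sum_(s | s != k) _](bigD1 l) //=.
set SD := \sum_(s | _) nu s * x s; set SQ := \sum_(s | _) nu s * w s.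
set SX := \sum_(s | _) 4 * c l s * (x s * w l - w s * x l).
set SY := \sum_(s | _) 4 * c l s * (w s * y l - w l * y s).
set SW := \sum_(s | _) 2 * c l s * (x s * y l - x l * y s).
set T := \sum_(s | _) c k s * _.
(* The summands with an index s outside of k and l: c3 turns their part free of a into
   the opposite of the terms in SX, SY and SW, and cnu turns the rest into multiples of
   SD and SQ. *)
have -> : T = 4 * a ^+ 2 * nu l * nu k * x l * w k * SD
    - 4 * a ^+ 2 * nu l * nu k * x l * x k * SQ
    - c k l * (x k * SY + SX * y k - 2 * (w k * SW)).
  rewrite /SD /SQ /SX /SY /SW mulr_suml !mulr_sumr -!sumrB -!big_split /=.
  rewrite -sumrB mulr_sumr -sumrB; apply: eq_bigr => s /andP[sk sl].
  rewrite eq_sym in sk; rewrite eq_sym in sl.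
  have e1 := cnu sk; have e2 := c3 kl sk sl.
  apply/eqP; rewrite -subr_eq0; apply/eqP.
  (* The factor of the relation c3 is, up to sign, 4 times the determinant of the
     triples (x, y, w) at k, l and s. *)
  transitivity (4 * ((x l * w s - w l * x s) * y k - x k * (y l * w s - w l * y s)
       + w k * (y l * x s - y s * x l)) *
     (c k s * c l s - (c k l * c l s + c k s * c l k)) +
     4 * a ^+ 2 * nu l * x l * (x s * w k - x k * w s) *
       (c k s * (nu k - nu s) - nu k * nu s)); first by ring.
  by rewrite e1 e2 !subrr !mulr0 addr0.
move: SD SQ SX SY SW {T} => SD SQ SX SY SW eD; have e1 := cnu kl.
rewrite (cC l k).
transitivity ((4 * a ^+ 2 * nu l * x l * (x l * w k - x k * w l)
     - 4 * a * (x l * w k - w l * x k)) * (c k l * (nu k - nu l) - nu k * nu l)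
  + 4 * a * nu l * nu k * x l * w k *
    (a * (1 + (nu k * x k + (nu l * x l + SD))) - 1)); first by ring.
by rewrite eD e1 !subrr !mulr0 addr0.
Qed.

Let Lx k s : br (gL k k) (x s) = 0.
Proof.
rewrite brC br_gL !bE eq_sym; case: eqP => [->|_]; last by rewrite !mulr0n; ring.
by rewrite !mulr1n; ring.
Qed.

Let Ly k s : br (gL k k) (y s) = 0.
Proof.
rewrite brC br_gL !bE eq_sym; case: eqP => [->|_]; last by rewrite !mulr0n; ring.
by rewrite !mulr1n; ring.
Qed.

Let Lw k s : br (gL k k) (w s) = 0.
Proof.
rewrite brC br_gL !bE eq_sym; case: eqP => [->|_]; last by rewrite !mulr0n; ring.
by rewrite !mulr1n; ring.
Qed.

(** The diagonal forms are the Casimir elements of the sl(2) triples. *)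
Lemma gL_diag_commute k l : br (gL k k) (gI l) = 0.
Proof.
rewrite br_gI br_a big1 => [|s _]; last by rewrite Lx mulr0.
rewrite big1 => [|s _]; last by rewrite br_gL !Lx !Ly !Lw; ring.
by rewrite Lx Ly; ring.
Qed.

Let br_scale u v t : br u v = 0 -> br u t = 0 -> br u (v * t) = 0.
Proof. by move=> h1 h2; rewrite brM h1 h2 mul0r mulr0 addr0. Qed.

Let br_nuX u k n : br u (nu k ^+ n) = 0.
Proof.
elim: n => [|n IH]; first by rewrite expr0 br1.
by rewrite exprS br_scale // bnu.
Qed.

Let br_nat u n : br u n%:R = 0.
Proof.
by elim: n => [|n IH]; rewrite ?br0 // -[n.+1]addn1 natrD brD IH br1 addr0.
Qed.

(** The indices of B, Q and J are shifted: [gD n] is D_n, but [gB n], [gQ n] and [gJ n]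
    are B_(n+1), Q_(n+1) and J_(n+1). *)
Definition gD n := \sum_k nu k ^+ n * x k.
Definition gB n := \sum_k nu k ^+ n * y k.
Definition gQ n := \sum_k nu k ^+ n * w k.

Definition gJ n := a * gD n.+1 + gB n +
  \sum_(i < n) (gD (n - i) * gB i.+1 - gQ (n - i) * gQ i.+1).

(** Symmetrizing the sum of nu_k^n I_k turns its coefficients into the divided
    differences of t^n; the diagonal values of these are supplied by the Casimir
    elements, after which the double sum factors. *)
Lemma gJE n : 2 * gJ n =
  2 * (\sum_k nu k ^+ n * gI k) + n%:R * \sum_k nu k ^+ n.+1 * gL k k.
Proof.
have gLC k l : gL k l = gL l k by rewrite /gL; ring.
have e1 : \sum_k nu k ^+ n * gI k = a * gD n.+1 + gB n +
    \sum_k \sum_(s | s != k) nu k ^+ n * (c k s * gL k s).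
  rewrite /gD /gB mulr_sumr -!big_split; apply: eq_bigr => k _ /=.
  by rewrite /gI 2!mulrDr mulr_sumr exprS; congr (_ + _ + _); ring.
have e2 : 2 * (\sum_k \sum_(s | s != k) nu k ^+ n * (c k s * gL k s)) =
    \sum_k \sum_(s | s != k) (nu k ^+ n - nu s ^+ n) * (c k s * gL k s).
  under [RHS]eq_bigr => k _ do under eq_bigr => s _ do rewrite mulrBl.
  under [RHS]eq_bigr => k _ do rewrite sumrB.
  rewrite sumrB [X in _ = _ - X](exchange_big_dep xpredT) //= -sumrN.
  rewrite mulrDl mul1r; congr (_ + _); apply: eq_bigr => k _.
  rewrite -sumrN; under eq_bigl => s do rewrite eq_sym.
  by apply: eq_bigr => s _; rewrite (cC s k) (gLC s k); ring.
have e3 : \sum_k \sum_(s | s != k) (nu k ^+ n - nu s ^+ n) * (c k s * gL k s) +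
    n%:R * (\sum_k nu k ^+ n.+1 * gL k k) =
    \sum_k \sum_s \sum_(i < n) nu k ^+ (n - i) * nu s ^+ i.+1 * gL k s.
  rewrite mulr_sumr -big_split; apply: eq_bigr => k _ /=.
  rewrite [RHS](bigD1 k) //= addrC; congr (_ + _).
    rewrite -mulr_suml mulrA; congr (_ * _).
    transitivity (\sum_(i < n) nu k ^+ n.+1).
      by rewrite sumr_const card_ord mulr_natl.
    apply: eq_bigr => i _; rewrite -exprD; congr (_ ^+ _).
    by have := ltn_ord i; lia.
  apply: eq_bigr => s sk; rewrite eq_sym in sk; have e := cnu sk.
  rewrite -mulr_suml subrXX mulrA; congr (_ * _).
  rewrite mulrAC [(_ - _) * _]mulrC e mulr_sumr; apply: eq_bigr => i _.
  have -> : (n - i = (n.-1 - i).+1)%N by have := ltn_ord i; lia.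
  by rewrite !exprS; ring.
rewrite e1 [X in _ = X + _]mulrDr e2 -addrA e3 [LHS]mulrDr; congr (_ + _).
have e4 : \sum_(i < n) gD i.+1 * gB (n - i) = \sum_(i < n) gD (n - i) * gB i.+1.
  rewrite (reindex_inj rev_ord_inj) /=; apply: eq_bigr => i _.
  by congr (gD _ * gB _); have := ltn_ord i; lia.
rewrite mulr_sumr.
transitivity (\sum_(i < n) (gD (n - i) * gB i.+1 + gD i.+1 * gB (n - i)
    - 2 * (gQ (n - i) * gQ i.+1))).
  rewrite sumrB big_split /= e4 -big_split -sumrB; apply: eq_bigr => i _ /=.
  by ring.
under [RHS]eq_bigr => k _ do rewrite exchange_big.
rewrite exchange_big /=; apply: eq_bigr => i _.
rewrite /gD /gB /gQ !big_distrlr /= mulr_sumr [X in _ + X - _]exchange_big /=.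
rewrite -big_split -sumrB; apply: eq_bigr => k _ /=.
rewrite mulr_sumr -big_split -sumrB; apply: eq_bigr => s _ /=.
by rewrite /gL; ring.
Qed.

(** With E_j = B_j / a + a D_j and F_j = B_j / a - a D_j, the factors a cancel in
    E_j E_k - F_j F_k = 2 (B_j D_k + D_j B_k). *)
Lemma sum_EE_FF (b : A) n : a * b = 1 ->
  let E j := gB j.-1 * b + a * gD j in let F j := gB j.-1 * b - a * gD j in
  \sum_(2 <= j < n.+1) (E j * E (n.+2 - j)%N - F j * F (n.+2 - j)%N) =
  4 * \sum_(i < n.-1) gD (n - i) * gB i.+1.
Proof.
move=> ab E F; have [n0|n0] := leqP n 0.
  by move: n0; rewrite leqn0 => /eqP ->; rewrite big_geq // big_ord0 mulr0.
rewrite (big_addn 0 n.+1 2) big_mkord subSS.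
have -> : (n - 1 = n.-1)%N by lia.
transitivity (\sum_(i < n.-1) (2 * (gD (n - i) * gB i.+1)
    + 2 * (gD i.+2 * gB (n - i).-1))).
  apply: eq_bigr => i _; rewrite /E /F addn2 !subSS /=.
  move: (gB _) (gB _) (gD _) (gD _) => B1 B2 D1 D2.
  transitivity (2 * (a * b) * (D2 * B1 + D1 * B2)); first by ring.
  by rewrite ab; ring.
have e : \sum_(i < n.-1) gD i.+2 * gB (n - i).-1 = \sum_(i < n.-1) gD (n - i) * gB i.+1.
  rewrite (reindex_inj rev_ord_inj) /=; apply: eq_bigr => i _.
  by congr (gD _ * gB _); have := ltn_ord i; lia.
by rewrite big_split /= -!mulr_sumr e; ring.
Qed.

Theorem gJ_commute n l : br (gI l) (2 * gJ n) = 0.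
Proof.
have eI : br (gI l) (\sum_k nu k ^+ n * gI k) = 0.
  rewrite br_sum big1 // => k _; apply: br_scale; first exact: br_nuX.
  have [->|lk] := eqVneq l k; [exact: br_alt | exact: gI_commute].
have eL : br (gI l) (\sum_k nu k ^+ n.+1 * gL k k) = 0.
  rewrite br_sum big1 // => k _; apply: br_scale; first exact: br_nuX.
  by rewrite brC gL_diag_commute oppr0.
rewrite gJE brD br_scale ?br2 // add0r.
by apply: br_scale; [apply: br_nat | apply: eL].
Qed.

End Gaudin.

(** * Exponentials of balanced series *)

Section Exponential.
Variable R : realType.
Local Notation C := R[i].
Implicit Types F G H S T U : fps C.

Definition divided_ad S k G : fps C := (k`!%:R)^-1 *: iter k (poisson S) G.

Lemma divided_ad0 S G : divided_ad S 0 G = G.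
Proof. by rewrite /divided_ad fact0 invr1 scale1r. Qed.

Section OneGenerator.
Variable S : fps C.
Hypotheses (bS : balanced S) (oS : vord 3 S).

Lemma iter_balanced k G : balanced G -> balanced (iter k (poisson S) G).
Proof. by move=> g; elim: k => // k IH; apply: poisson_balanced. Qed.

Lemma iter_vord n k G : vord n G -> vord (n + k) (iter k (poisson S) G).
Proof.
move=> g; elim: k => [|k IH]; first by rewrite addn0.
by apply: (poisson_vord oS IH); lia.
Qed.

Lemma iter_real k G : real_fps S -> real_fps G -> real_fps (iter k (poisson S) G).
Proof. by move=> rS g; elim: k => // k IH; apply: poisson_real. Qed.

Lemma divided_ad_balanced k G : balanced G -> balanced (divided_ad S k G).
Proof. by move=> g; apply/balancedZ/iter_balanced. Qed.

Lemma divided_ad_vord k G : vord k (divided_ad S k G).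
Proof. exact/vordZ/(@iter_vord 0). Qed.

Lemma divided_adS k G : poisson S (divided_ad S k G) = k.+1%:R *: divided_ad S k.+1 G.
Proof.
rewrite /divided_ad poissonZr // scalerA factS natrM invfM mulrA divff ?mul1r //.
by rewrite pnatr_eq0.
Qed.

Lemma exp_adE n m G : (mdeg m < n)%N ->
  exp_ad S G m = (\sum_(k < n) divided_ad S k G) m.
Proof.
move=> mn; rewrite fps_coef_sum -(big_mkord xpredT (fun k => divided_ad S k G m)).
rewrite [LHS]/= (fsbigE (index_iota 0 n)) ?iota_uniq //.
  by apply: eq_bigl => k; rewrite in_setT.
move=> k _; rewrite mem_index_iota /= -leqNgt => nk.
by apply: divided_ad_vord; apply: leq_trans nk.
Qed.

Lemma exp_ad_rem n G : vord n (exp_ad S G - \sum_(k < n) divided_ad S k G).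
Proof. by move=> m mn; rewrite fpsD fpsN (exp_adE _ mn) subrr. Qed.

Lemma exp_ad_balanced G : balanced G -> balanced (exp_ad S G).
Proof. by move=> g; apply: balanced_fps_sum => k _; apply: divided_ad_balanced. Qed.

Lemma exp_ad_real G : real_fps S -> real_fps G -> real_fps (exp_ad S G).
Proof.
move=> rS g a b; pose n := (maxn (mdeg (a, b)) (mdeg (b, a))).+1.
rewrite !(@exp_adE n) ?ltnS ?leq_maxl ?leq_maxr //.
apply: real_fps_sum => k _; apply: real_fpsZ; last exact: iter_real.
by rewrite fmorphV /= conjC_nat.
Qed.

Lemma exp_ad_vord n G : vord n G -> vord n.+1 (exp_ad S G - G).
Proof.
move=> g m mn; rewrite fpsD fpsN (exp_adE _ (ltnSn _)) big_ord_recl divided_ad0 fpsD.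
rewrite addrC addKr fps_coef_sum big1 // => k _; rewrite fpsZ (iter_vord g) ?mulr0 //.
by apply: leq_trans mn _; rewrite lift0 addnS ltnS leq_addr.
Qed.

Lemma exp_ad_id G : poisson S G = 0 -> exp_ad S G = G.
Proof.
move=> SG; apply/fpsP => m; rewrite (exp_adE _ (ltnSn _)) big_ord_recl divided_ad0 fpsD.
rewrite fps_coef_sum big1 ?addr0 // => k _.
rewrite /divided_ad lift0; suff -> : iter k.+1 (poisson S) G = 0 by rewrite scaler0.
elim: (k : nat) => [|l IH]; first exact: SG.
by rewrite iterS IH poisson0r.
Qed.

(** The divided powers f_a, g_b of ad_S on F and G satisfy
    ad_S (sum_(a+b=n) {f_a, g_b}) = (n+1) sum_(a+b=n+1) {f_a, g_b},
    by the Jacobi identity. *)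
Lemma divided_ad_commute F G n : balanced F -> balanced G -> poisson F G = 0 ->
  \sum_(k < n.+1) poisson (divided_ad S k F) (divided_ad S (n - k) G) = 0.
Proof.
move=> bF bG FG; elim: n => [|n IH].
  by rewrite big_ord_recl big_ord0 !divided_ad0 addr0.
pose t k := poisson (divided_ad S k F) (divided_ad S (n.+1 - k) G).
have E : poisson S (\sum_(k < n.+1) poisson (divided_ad S k F) (divided_ad S (n - k) G)) =
    n.+1%:R *: \sum_(k < n.+2) t k.
  rewrite poisson_sumr //.
  transitivity (\sum_(k < n.+1) (k.+1%:R *: t k.+1 + (n.+1 - k)%:R *: t k)).
    apply: eq_bigr => k _.
    rewrite poisson_jacobi //; try exact: divided_ad_balanced.
    rewrite !divided_adS poissonZl; try exact: divided_ad_balanced.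
    rewrite poissonZr; last exact: divided_ad_balanced.
    rewrite /t subSS; have -> // : (n.+1 - k = (n - k).+1)%N.
    by have := ltn_ord k; lia.
  rewrite big_split /= scaler_sumr.
  transitivity (\sum_(k < n.+2) k%:R *: t k + \sum_(k < n.+2) (n.+1 - k)%:R *: t k).
    congr (_ + _); first by rewrite [RHS]big_ord_recl scale0r add0r.
    by rewrite [RHS]big_ord_recr /= subnn scale0r addr0.
  rewrite -big_split; apply: eq_bigr => k _ /=.
  by rewrite -scalerDl -natrD subnKC // -ltnS.
move: E; rewrite IH poisson0r // => /esym/eqP.
by rewrite scaler_eq0 pnatr_eq0 /= => /eqP.
Qed.

End OneGenerator.

Lemma triangle_sum (V : nmodType) n (g : nat -> nat -> V) :
  \sum_(a < n) \sum_(b < n - a) g a b = \sum_(r < n) \sum_(a < r.+1) g a (r - a)%N.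
Proof.
elim: n => [|n IH]; first by rewrite !big_ord0.
rewrite [RHS]big_ord_recr /= -IH [X in _ = _ + X]big_ord_recr /=.
rewrite subnn addrA -big_split /= [LHS]big_ord_recr /=.
rewrite subSnn big_ord1; congr (_ + _).
apply: eq_bigr => a _; rewrite subSn; last by have := ltn_ord a; lia.
by rewrite big_ord_recr.
Qed.

(** Up to high order both exponentials are finite sums of divided powers; the brackets
    of these with a given total power add up to zero by [divided_ad_commute]. *)
Lemma exp_ad_commute S F G : balanced S -> vord 3 S -> balanced F -> balanced G ->
  poisson F G = 0 -> poisson (exp_ad S F) (exp_ad S G) = 0.
Proof.
move=> bS oS bF bG FG; apply/fpsP => m; pose n := (mdeg m).+3.
pose f k := divided_ad S k F; pose g k := divided_ad S k G.
have bf k : balanced (f k) by apply: divided_ad_balanced.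
have bg k : balanced (g k) by apply: divided_ad_balanced.
have of_ k : vord k (f k) by apply: divided_ad_vord.
have og k : vord k (g k) by apply: divided_ad_vord.
have bEF : balanced (exp_ad S F) by apply: exp_ad_balanced.
have bEG : balanced (exp_ad S G) by apply: exp_ad_balanced.
have small u v (X Y : fps C) : (n <= u + v)%N -> vord u X -> vord v Y -> poisson X Y m = 0.
  by move=> nuv oX oY; apply: (poisson_vord oX oY (l := (mdeg m).+1)); rewrite /n in nuv; lia.
have rF : vord n (exp_ad S F - \sum_(k < n) f k) by exact: exp_ad_rem.
have rG : vord n (exp_ad S G - \sum_(k < n) g k) by exact: exp_ad_rem.
set PF := \sum_(k < n) f k in rF; set PG := \sum_(k < n) g k in rG.
have bPF : balanced PF by apply: balanced_sum.
have bPG : balanced PG by apply: balanced_sum.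
have -> : poisson (exp_ad S F) (exp_ad S G) m = poisson PF PG m.
  rewrite -[exp_ad S F](subrK PF) poissonDl //; last exact: balancedB.
  rewrite fpsD (small n 0%N _ _ _ rF (@vord0 _ _)) ?addn0 // add0r.
  rewrite -[exp_ad S G](subrK PG) poissonDr // fpsD.
  by rewrite (small 0%N n _ _ _ (@vord0 _ _) rG) // add0r.
rewrite poisson_suml // fps_coef_sum.
transitivity (\sum_(a < n) \sum_(b < n - a) poisson (f a) (g b) m).
  apply: eq_bigr => a _; rewrite poisson_sumr // fps_coef_sum.
  rewrite -(big_mkord xpredT (fun b => poisson (f a) (g b) m)).
  rewrite (@big_cat_nat _ _ _ (n - a)) ?leq_subr //= big_mkord.
  rewrite [X in _ + X]big_nat_cond [X in _ + X]big1 ?addr0 // => b /andP[/andP[ab _] _].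
  by apply: (small a b _ _ _ (of_ a) (og b)); rewrite -leq_subLR.
rewrite (triangle_sum n (fun a b => poisson (f a) (g b) m)) big1 // => r _.
by rewrite -fps_coef_sum divided_ad_commute.
Qed.

(** At the degree where the generator is modified, only the first bracket with the
    modification is felt; this allows the generator to be chosen degree by degree. *)
Lemma exp_ad_perturb d T U G : balanced T -> balanced U -> balanced G ->
  vord 3 T -> vord d U -> (3 <= d)%N -> vord 2 G ->
  vord d.+1 (exp_ad (T + U) G - exp_ad T G - poisson U G).
Proof.
move=> bT bU bG oT oU d3 oG.
have bS : balanced (T + U) by apply: balancedD.
have oS : vord 3 (T + U) by apply: vordD => //; apply: vordW oU.
have E1 : poisson (T + U) G - poisson T G = poisson U G.
  by rewrite poissonDl // addrC addKr.
have E k : vord (d + k) (iter k.+1 (poisson (T + U)) G - iter k.+1 (poisson T) G).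
  elim: k => [|k IH]; first by rewrite E1; apply: (poisson_vord oU oG); lia.
  have := @iter_balanced _ bS k.+1 _ bG; have := @iter_balanced _ bT k.+1 _ bG.
  have oY := @iter_vord _ oT 2 k.+1 _ oG.
  rewrite !(iterS k.+1); move: (iter _ _ _) (iter _ _ _) oY IH => X Y oY oXY bY bX.
  have -> : poisson (T + U) X - poisson T Y = poisson (T + U) (X - Y) + poisson U Y.
    by rewrite poissonBr // [in RHS](poissonDl bT bU bY) opprD; ring.
  by apply: vordD; [apply: (poisson_vord oS oXY) | apply: (poisson_vord oU oY)]; lia.
move=> m md; rewrite -E1 !fpsD !fpsN !fpsD !fpsN.
rewrite !(@exp_adE _ _ (mdeg m).+2) // !fps_coef_sum.
rewrite 2![\sum_(k < _.+2) _]big_ord_recl !divided_ad0.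
rewrite 2![\sum_(k < _.+1) _]big_ord_recl.
have D1 V : divided_ad V (lift ord0 ord0) G m = poisson V G m.
  by rewrite /divided_ad lift0 invr1 scale1r.
rewrite !D1.
transitivity (\sum_(k < mdeg m) (divided_ad (T + U) k.+2 G m - divided_ad T k.+2 G m)).
  rewrite sumrB; ring.
apply: big1 => k _; rewrite /divided_ad !fpsZ -mulrBr.
have -> : forall X Y : fps C, X m - Y m = (X - Y) m by [].
by rewrite E ?mulr0 //; move: md; lia.
Qed.

End Exponential.

(** * Simultaneous normalization *)

Section Normalization.
Variable R : realType.
Local Notation C := R[i].
Implicit Types F G H S T U : fps C.

(** The action |z_j|^2. *)
Definition act (j : idx) : fps C := mon C (ev true j) * mon C (ev false j).

Lemma actE j : act j = mon C (unitv j, unitv j).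
Proof. by rewrite ev_pair monD. Qed.

Lemma poisson_act F j m :
  poisson F (act j) m = 'i * ((m.1 j)%:R - (m.2 j)%:R) * F m.
Proof.
have dact b i : d b i (act j) = (i == j)%:R * mon C (ev (~~ b) j).
  rewrite dM !d_ev; case: b => /=; move: (i == j)%:R => e.
    by rewrite mulr0 addr0.
  by rewrite mul0r add0r mulrC.
rewrite poissonE -mulrA; congr (_ * _).
transitivity (pb j F (act j) m); last first.
  by rewrite /pb !dact eqxx mulr1n !mul1r !d_mon fpsD fpsN !eulerE mulrBl.
rewrite (fsbigE [:: j]) //; first last.
- move=> i _; rewrite inE => /negbTE ij.
  by rewrite /pb !dact ij mulr0n !mul0r !mulr0 subrr.
by rewrite big_cons big_nil in_setT; apply: addr0.
Qed.

Definition normal (m : mono) : bool := m.1 == m.2.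

Definition normal_fps F : Prop := forall m, ~~ normal m -> F m = 0.

Definition normal_part F : fps C := FPS (fun m => if normal m then F m else 0).

Lemma normal_partE F m : normal_part F m = if normal m then F m else 0.
Proof. by []. Qed.

Lemma normal_part_normal_fps F : normal_fps (normal_part F).
Proof. by move=> m /negbTE nm; rewrite normal_partE nm. Qed.

Lemma normal_part_balanced F : balanced F -> balanced (normal_part F).
Proof. by move=> f m bm; rewrite normal_partE f // if_same. Qed.

Lemma poisson_normal_fps F G : normal_fps F -> normal_fps G -> poisson F G = 0.
Proof.
move=> f g; apply/fpsP => m; rewrite [LHS]/= fsbig1 ?mulr0 // => j _.
rewrite fsbig1 // => -[x y] _ /=.
have [/eqP nx|nx] := boolP (normal x); last by rewrite f // !mul0r.
have [/eqP ny|ny] := boolP (normal y); last by rewrite g // mulr0 mul0r.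
by rewrite nx ny subrr mulr0.
Qed.

Variable (c : nat -> C) (I : nat -> fps C).

Definition quad l : fps C := c l *: (act (jp l) + act (jm l)).

Definition freq l (m : mono) : C := c l *
  ((m.1 (jp l))%:R - (m.2 (jp l))%:R + ((m.1 (jm l))%:R - (m.2 (jm l))%:R)).

Hypotheses (c0 : forall l, c l != 0) (cR : forall l, (c l)^* = c l).
Hypotheses (bI : forall l, balanced (I l)) (rI : forall l, real_fps (I l)).
Hypotheses (qI : forall l, vord 3 (I l - quad l)).
Hypothesis (II : forall k l, poisson (I k) (I l) = 0).

Lemma act_balanced j : balanced (act j).
Proof. by rewrite actE; apply/balanced_mon/bal_pair. Qed.

Lemma act_normal_fps j : normal_fps (act j).
Proof.
by move=> m nm; rewrite actE monE; case: eqP nm => // ->; rewrite /normal eqxx.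
Qed.

Lemma quad_balanced l : balanced (quad l).
Proof. by apply/balancedZ/balancedD; apply: act_balanced. Qed.

Lemma quad_normal_fps l : normal_fps (quad l).
Proof. by move=> m nm; rewrite fpsZ fpsD !act_normal_fps // addr0 mulr0. Qed.

Lemma quad_vord l : vord 2 (quad l).
Proof.
have E j : vord 2 (act j).
  move=> m; rewrite actE monE; case: eqP => // ->.
  by rewrite ev_pair mdegD !mdeg_ev.
by apply/vordZ/vordD.
Qed.

Lemma I_vord l : vord 2 (I l).
Proof.
rewrite -[I l](subrK (quad l)); apply: vordD; last exact: quad_vord.
exact: (vordW _ (@qI l)).
Qed.

Lemma poisson_quad F l m : balanced F ->
  poisson F (quad l) m = 'i * freq l m * F m.
Proof.
move=> f; rewrite poissonZr // poissonDr // fpsZ fpsD !poisson_act /freq.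
by ring.
Qed.

Lemma freq_sw l a b : freq l (b, a) = - freq l (a, b).
Proof. by rewrite /freq /=; ring. Qed.

Lemma freq_real l m : (freq l m)^* = freq l m.
Proof. by rewrite /freq rmorphM /= cR rmorphD /= !rmorphB /= !conjC_nat. Qed.

(** The frequencies only see the defect alpha - beta summed over j and -j; on a balanced
    monomial the defects at j and -j are equal. *)
Lemma freq_nonresonant m : bal m -> ~~ normal m -> exists l, freq l m != 0.
Proof.
move=> bm; apply: contraNP => h; apply/eqP/expoP.
have E l : m.1 (jp l) = m.2 (jp l).
  apply/eqP/negP => /negP ne; case: h; exists l; rewrite mulf_neq0 //.
  have -> : (m.1 (jm l))%:R - (m.2 (jm l))%:R = (m.1 (jp l))%:R - (m.2 (jp l))%:R :> C.
    have := bm (jp l); rewrite -/(jm l) => /(congr1 (fun n => n%:R : C)).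
    rewrite !natrD => /eqP; rewrite -subr_eq0 => /eqP e.
    apply/esym/eqP; rewrite -subr_eq0; apply/eqP; apply: etrans e; ring.
  by rewrite -mulr2n mulrn_eq0 /= subr_eq0 eqr_nat.
move=> j; have [l [->|->]] := idx_cases j; first exact: E.
by have := bm (jp l); rewrite E -/(jm l) => /addnI ->.
Qed.

(** At the lowest degree where F or G fails to be normal, the vanishing of {F, G}
    reduces to the bracket of the quadratic part of F with the defect of G. *)
Lemma bracket_lowest_defect d m k F G : balanced F -> balanced G ->
  vord 3 (F - quad k) -> mdeg m = d -> ~~ normal m ->
  (forall n, (mdeg n < d)%N -> ~~ normal n -> G n = 0) ->
  poisson F G m = 0 -> poisson (F - normal_part F) G m = 0 ->
  freq k m * G m = 0.
Proof.
move=> bF bG qF md nm hG FG FrG.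
have bnF := normal_part_balanced bF; have bnG := normal_part_balanced bG.
have oGr : vord d (G - normal_part G).
  move=> n nd; rewrite fpsD fpsN normal_partE; case: ifPn => nn; first by rewrite subrr.
  by rewrite hG // subr0.
have bGr : balanced (G - normal_part G) by apply: balancedB.
have e1 : poisson (normal_part F) G m = 0.
  have := FG; rewrite -{1}[F](subrK (normal_part F)) poissonDl //; last exact: balancedB.
  by rewrite fpsD FrG add0r.
have e2 : poisson (normal_part F) (G - normal_part G) m = 0.
  have nFG := poisson_normal_fps (@normal_part_normal_fps F) (@normal_part_normal_fps G).
  by rewrite poissonBr // fpsD fpsN e1 nFG subr0.
have bq := quad_balanced k.
have oFq : vord 3 (normal_part F - quad k).
  move=> n n3; have := qF n n3; rewrite !fpsD !fpsN normal_partE.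
  by case: ifPn => // nn _; rewrite quad_normal_fps // subr0.
have e3 : poisson (quad k) (G - normal_part G) m = 0.
  have := e2; rewrite -{1}[normal_part F](subrK (quad k)) poissonDl //; last exact: balancedB.
  have o : vord d.+1 (poisson (normal_part F - quad k) (G - normal_part G)).
    by apply: (poisson_vord oFq oGr); lia.
  by rewrite fpsD (o m) ?add0r // md.
move: e3; rewrite poissonC // fpsN poisson_quad // fpsD fpsN normal_partE (negbTE nm) subr0.
move/eqP; rewrite oppr_eq0 -mulrA mulf_eq0 (negbTE (neq0Ci _)) /=.
by move/eqP.
Qed.

Lemma poisson0l G : balanced G -> poisson 0 G = 0.
Proof. by move=> g; rewrite poissonC // poisson0r // oppr0. Qed.

(** ** The generator, one degree at a time *)

(** The homological equation at m is solved with one member of the family whose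
    frequency does not vanish at m; since the members commute, any other one would
    give the same coefficient. *)
Definition pick (m : mono) : nat := xget 0%N [set l | freq l m != 0].

Lemma pick_neq0 m : bal m -> ~~ normal m -> freq (pick m) m != 0.
Proof.
move=> bm nm; have [l hl] := freq_nonresonant bm nm.
exact: (@xgetPex _ 0%N [set l | freq l m != 0] (ex_intro _ l hl)).
Qed.

Definition corr (d : nat) T : fps C := FPS (fun m =>
  if (3 <= d)%N && (mdeg m == d)
  then 'i * exp_ad T (I (pick m)) m / freq (pick m) m else 0).

Lemma corr_def d T m : corr d T m = if (3 <= d)%N && (mdeg m == d)
  then 'i * exp_ad T (I (pick m)) m / freq (pick m) m else 0.
Proof. by []. Qed.

Fixpoint gen (d : nat) : fps C :=
  if d is e.+1 then gen e + corr e (gen e) else 0.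

Lemma genS e : gen e.+1 = gen e + corr e (gen e). Proof. by []. Qed.

Definition generator : fps C := FPS (fun m => gen (mdeg m).+1 m).

Lemma corrE d T m : (3 <= d)%N -> mdeg m = d ->
  corr d T m = 'i * exp_ad T (I (pick m)) m / freq (pick m) m.
Proof. by move=> d3 md; rewrite corr_def d3 md eqxx. Qed.

Lemma corr0 d T m : mdeg m <> d \/ (d < 3)%N -> corr d T m = 0.
Proof.
move=> h; rewrite corr_def; case: ifP => // /andP[d3 /eqP md].
by case: h => // dl; move: d3; rewrite leqNgt dl.
Qed.

Lemma gen_balanced d : balanced (gen d).
Proof.
elim: d => [|d IH]; first exact: balanced0.
apply: balancedD => // m bm; rewrite corr_def; case: ifP => // _.
by rewrite (exp_ad_balanced IH (bI _)) // mulr0 mul0r.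
Qed.

Lemma gen_vord d : vord 3 (gen d).
Proof.
elim: d => [|d IH] //; apply: vordD => // m m3; apply: corr0.
have [d3|] := ltnP d 3; [by right | move=> d3; left].
by move=> md; move: m3; rewrite md ltnNge d3.
Qed.

Lemma gen_real d : real_fps (gen d).
Proof.
elim: d => [|d IH]; first by move=> a b; rewrite rmorph0.
apply: real_fpsD => // a b.
have dC : mdeg (b, a) = mdeg (a, b) by rewrite /mdeg addnC.
have pC : pick (b, a) = pick (a, b).
  rewrite /pick; congr (xget _ _); apply/seteqP; split=> l /=;
  by rewrite freq_sw oppr_eq0.
rewrite !corr_def dC; case: ifP => _; last by rewrite rmorph0.
rewrite pC; have rE := exp_ad_real (gen_balanced d) (gen_vord d) IH (rI (pick (a, b))).
move: (exp_ad _ _) rE => X rE.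
rewrite !rmorphM fmorphV /= -(rE a b) conjCi freq_real (freq_sw _ a b) invrN.
by ring.
Qed.

Lemma gen_stable d e m : (mdeg m < d)%N -> gen (d + e) m = gen d m.
Proof.
move=> md; elim: e => [|e IH]; first by rewrite addn0.
rewrite addnS genS fpsD IH corr0 ?addr0 //; left; move=> mde; move: md.
by rewrite mde; lia.
Qed.

Lemma gen_zero d m : (d <= mdeg m)%N -> gen d m = 0.
Proof.
elim: d => [|d IH] // dm; rewrite genS fpsD IH ?add0r; last by lia.
by apply: corr0; left; lia.
Qed.

Lemma generatorE d m : (mdeg m < d)%N -> generator m = gen d m.
Proof. by move=> md; rewrite -[d](subnKC md) gen_stable. Qed.

Lemma generator_balanced : balanced generator.
Proof. by move=> m bm; rewrite (generatorE (ltnSn _)); apply: gen_balanced. Qed.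

Lemma generator_vord : vord 3 generator.
Proof. by move=> m m3; rewrite (generatorE (ltnSn _)); apply: gen_vord. Qed.

Lemma generator_real : real_fps generator.
Proof.
move=> a b; have dC : mdeg (b, a) = mdeg (a, b) by rewrite /mdeg addnC.
have e := @generatorE _ (b, a) (ltnSn _); rewrite dC in e.
apply: etrans (@generatorE _ (a, b) (ltnSn _)) _.
apply: etrans (gen_real _ a b) _; exact: congr1 _ (esym e).
Qed.

Local Notation bS := generator_balanced.
Local Notation oS := generator_vord.
Local Notation E := (exp_ad generator).

Lemma exp_pick m : (3 <= mdeg m)%N -> freq (pick m) m != 0 ->
  E (I (pick m)) m = 0.
Proof.
set k := pick m; set d := mdeg m => d3 fm.
pose T := gen d; pose U := generator - T.
have bT : balanced T by apply: gen_balanced.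
have bU : balanced U by apply: balancedB => //; apply: bS.
have oU : vord d U by move=> n nd; rewrite fpsD fpsN (generatorE nd) subrr.
have UE : U m = 'i * exp_ad T (I k) m / freq k m.
  rewrite fpsD fpsN (@generatorE d.+1) // /T genS fpsD (@gen_zero d) // subr0.
  by rewrite add0r corrE.
have := exp_ad_perturb bT bU (@bI k) (@gen_vord d) oU d3 (@I_vord k) (ltnSn d).
have -> : T + U = generator by rewrite addrC subrK.
have e : poisson U (I k) m = 'i * freq k m * U m.
  rewrite -[I k](subrK (quad k)) poissonDr // fpsD poisson_quad //.
  have o : vord d.+1 (poisson U (I k - quad k)).
    by apply: (poisson_vord oU (@qI k)); lia.
  by rewrite (o m) ?add0r.
rewrite !fpsD !fpsN e UE.
have -> : 'i * freq k m * ('i * exp_ad T (I k) m / freq k m) = - exp_ad T (I k) m.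
  transitivity ('i ^+ 2 * exp_ad T (I k) m * (freq k m / freq k m)); first by ring.
  by rewrite divff // mulr1 sqrCi mulN1r.
by rewrite opprK subrK.
Qed.

Lemma exp_quad l : vord 3 (E (I l) - quad l).
Proof.
rewrite -[E (I l)](subrK (I l)) -addrA; apply: vordD; last exact: qI.
exact: exp_ad_vord oS _ _ (@I_vord l).
Qed.

Lemma exp_bI l : balanced (E (I l)).
Proof. exact: exp_ad_balanced bS _ (bI l). Qed.

(** At each monomial the picked member is normalized by construction; the other members
    follow by induction on the degree, because they commute with it. *)
Lemma exp_I_normal l : normal_fps (E (I l)).
Proof.
suff H d : forall m k, (mdeg m < d)%N -> ~~ normal m -> E (I k) m = 0.
  by move=> m; apply: (H (mdeg m).+1).
elim: d => [|d IH] // m k; rewrite ltnS leq_eqVlt => /orP[/eqP md|md] nm;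
  last exact: IH.
have [bm|nb] := pselect (bal m); last by rewrite exp_bI.
have [d3|d3] := ltnP d 3.
  have := @exp_quad k m; rewrite md => /(_ d3).
  by rewrite fpsD fpsN quad_normal_fps // subr0.
have fm := pick_neq0 bm nm; set p := pick m in fm.
suff : freq p m * E (I k) m = 0.
  by move/eqP; rewrite mulf_eq0 (negbTE fm) => /eqP.
apply: (@bracket_lowest_defect d m p (E (I p))) => //; try exact: exp_bI.
- exact: exp_quad.
- by move=> n nd nn; apply: IH.
- by rewrite (exp_ad_commute bS oS (bI p) (bI k) (II p k)).
set Fr := _ - _.
have bFr : balanced Fr by apply: balancedB; [|apply: normal_part_balanced]; apply: exp_bI.
have oFr : vord d Fr.
  move=> n nd; rewrite fpsD fpsN normal_partE; case: ifPn => nn; first by rewrite subrr.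
  by rewrite IH // subr0.
rewrite -[E (I k)](subrK (quad k)) poissonDr // fpsD poisson_quad //.
have o : vord d.+1 (poisson Fr (E (I k) - quad k)).
  by apply: (poisson_vord oFr (@exp_quad k)); lia.
rewrite (o m) ?md // add0r fpsD fpsN normal_partE (negbTE nm) subr0 exp_pick ?mulr0 //.
by rewrite md.
Qed.

(** Likewise for anything that commutes with the family, its members being already in
    normal form. *)
Theorem exp_normal G : balanced G -> (forall k, poisson (I k) G = 0) -> normal_fps (E G).
Proof.
move=> bG cG.
have bEG : balanced (E G) by exact: exp_ad_balanced bS _ bG.
suff H d : forall m, (mdeg m < d)%N -> ~~ normal m -> E G m = 0.
  by move=> m; apply: (H (mdeg m).+1).
elim: d => [|d IH] // m; rewrite ltnS leq_eqVlt => /orP[/eqP md|md] nm;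
  last exact: IH.
have [bm|nb] := pselect (bal m); last by rewrite bEG.
have fm := pick_neq0 bm nm; set p := pick m in fm.
suff : freq p m * E G m = 0.
  by move/eqP; rewrite mulf_eq0 (negbTE fm) => /eqP.
apply: (@bracket_lowest_defect d m p (E (I p))) => //.
- exact: exp_bI.
- exact: exp_quad.
- by rewrite (exp_ad_commute bS oS (bI p) bG (cG p)).
rewrite (_ : _ - _ = 0) ?poisson0l //.
apply/fpsP => n; rewrite fpsD fpsN normal_partE; case: ifPn => nn; first by rewrite subrr.
by rewrite exp_I_normal // subrr.
Qed.

End Normalization.

(** * Normal forms and momentum *)

Section NormalForm.
Variable R : realType.
Local Notation C := R[i].

Lemma momentum_bal m : bal m -> momentum m = 0.
Proof.
move=> bm; have [N mN] := box_exists m; rewrite /momentum.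
rewrite (fsbigE (boxs N)) ?boxs_uniq //.
  under eq_bigl do rewrite in_setT.
  rewrite big_boxs big1 // => l _ /=; have := bm (jp l).
  rewrite -/(jm l).
  move: (m.1 (jp l)) (m.1 (jm l)) (m.2 (jp l)) (m.2 (jm l)) => a b e f h.
  have -> : a%:Z - e%:Z = b%:Z - f%:Z by lia.
  by rewrite -mulrDl subrr mul0r.
move=> j _; rewrite mem_boxs -ltnNge => Nj.
have := mN false j Nj; have := mN true j Nj; rewrite /cnt => -> ->.
by rewrite subrr mulr0.
Qed.

Lemma monX e n : mon C e ^+ n = mon C (e *+ n).
Proof.
elim: n => [|n IH]; first by rewrite expr0 mulr0n mon0.
by rewrite exprS mulrS monD IH.
Qed.

Lemma mono_sum (a : expo) :
  \sum_(j <- supp a) ((unitv j, unitv j) : mono) *+ a j = (a, a).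
Proof.
have mul1 (e : mono) n j : (e *+ n).1 j = (e.1 j * n)%N.
  by elim: n => [|n IH]; rewrite ?mulr0n ?expo0 ?muln0 // mulrS mono1D IH mulnS.
have mul2 (e : mono) n j : (e *+ n).2 j = (e.2 j * n)%N.
  by elim: n => [|n IH]; rewrite ?mulr0n ?expo0 ?muln0 // mulrS mono2D IH mulnS.
have E i : (\sum_(j <- supp a) unitv j i * a j)%N = a i.
  have [ia|ia] := boolP (i \in supp a).
    rewrite (bigD1_seq i) ?fset_uniq //= unitvE eqxx mul1n big1 ?addn0 // => j ji.
    by rewrite unitvE eq_sym (negbTE ji) mul0n.
  rewrite big1_seq; first by apply/esym; move: ia; rewrite memNfinsupp => /eqP.
  move=> j /andP[_ ja]; rewrite unitvE; case: eqP => [ij|_]; last exact: mul0n.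
  by rewrite ij ja in ia.
have S1 (f : idx -> mono) i :
    (\sum_(j <- supp a) f j).1 i = (\sum_(j <- supp a) (f j).1 i)%N.
  apply: (big_morph (fun x : mono => x.1 i)) => [x y|]; [exact: mono1D | exact: expo0].
have S2 (f : idx -> mono) i :
    (\sum_(j <- supp a) f j).2 i = (\sum_(j <- supp a) (f j).2 i)%N.
  apply: (big_morph (fun x : mono => x.2 i)) => [x y|]; [exact: mono2D | exact: expo0].
apply: injective_projections; apply/expoP => i /=.
  by rewrite S1 -[RHS]E; apply: eq_bigr => j _; rewrite mul1.
by rewrite S2 -[RHS]E; apply: eq_bigr => j _; rewrite mul2.
Qed.

Lemma pq_monomial (a : expo) :
  \prod_(j <- supp a) (p_ R j ^+ 2 + q_ R j ^+ 2) ^+ a j =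
  (\prod_(j <- supp a) 2 ^+ a j) *: mon C (a, a).
Proof.
rewrite -mono_sum (big_morph (mon C) (@monD _) (@mon0 _)) -scaler_prod.
apply: eq_bigr => j _; rewrite pq_z exprZn -monX; congr (_ *: _ ^+ _).
by rewrite /sqnorm fps_conj_z z_E zb_E -monD -ev_pair.
Qed.

Lemma normal_form_normal_fps (G : fps C) : normal_fps G -> real_fps G -> normal_form G.
Proof.
move=> nG rG.
exists (fun a => complex.Re (G (a, a)) / \prod_(j <- supp a) 2 ^+ a j).
have rE a : (complex.Re (G (a, a)))%:C%C = G (a, a).
  by apply: RRe_real; apply/CrealP; rewrite -rG.
set f := fun a : expo => _; apply/fpsP => m.
have -> : fps_sum [set: expo] f m = \sum_(a \in [set: expo]) f a m by [].
have T a : f a m = G (a, a) * (m == (a, a))%:R.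
  rewrite /f pq_monomial scalerA fpsZ monE; congr (_ * _).
  have -> : \prod_(j <- supp a) 2 ^+ a j = (\prod_(j <- supp a) 2 ^+ a j : R)%:C%C.
    by rewrite rmorph_prod; apply: eq_bigr => j _; rewrite rmorphXn rmorph_nat.
  rewrite rmorphM /= rE fmorphV -mulrA mulVf ?mulr1 //.
  rewrite fmorph_eq0; rewrite prodf_seq_neq0; apply/allP => j _ /=.
  by rewrite expf_neq0 // pnatr_eq0.
have [mn|mn] := boolP (normal m); last first.
  rewrite nG // fsbig1 // => a _; rewrite T; case: eqP => [ma|]; last by rewrite mulr0.
  by move: mn; rewrite ma /normal eqxx.
have mE : m = (m.1, m.1) by move/eqP: mn {T}; case: m => a b /= ->.
rewrite -(fsbig_widen [set m.1] setT) //.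
  by rewrite fsbig_set1 T -mE eqxx mulr1.
move=> a [_ am]; suff: f a m = 0 by [].
rewrite T; case: eqP => [ma|]; last by rewrite mulr0.
by case: am; rewrite ma.
Qed.

End NormalForm.

(** * Fourier coefficients and their brackets *)

Section Kirchhoff.
Variable R : realType.
Local Notation C := R[i].
Local Notation u := (u_ R).
Local Notation v := (v_ R).
Implicit Types F G : fps C.

Let al (j : idx) : C := (sqrtC (absj j)%:R * sqrtC 2)^-1.
Let be (j : idx) : C := sqrtC (absj j)%:R / (sqrtC 2 * 'i).

Lemma uE j : u j = al j *: (mon C (ev true j) + mon C (ev false (idx_opp j))).
Proof. by rewrite /u_ z_E zb_E. Qed.

Lemma vE j : v j = be j *: (mon C (ev true j) - mon C (ev false (idx_opp j))).
Proof. by rewrite /v_ z_E zb_E. Qed.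

Let rt0 j : sqrtC (absj j)%:R != 0 :> C.
Proof. by rewrite sqrtC_eq0 pnatr_eq0 -lt0n absj_gt0. Qed.

Let s20 : sqrtC 2 != 0 :> C.
Proof. by rewrite sqrtC_eq0 pnatr_eq0. Qed.

Let al_opp j : al (idx_opp j) = al j. Proof. by rewrite /al absj_opp. Qed.
Let be_opp j : be (idx_opp j) = be j. Proof. by rewrite /be absj_opp. Qed.

Let al2 j : al j ^+ 2 = (2 * (absj j)%:R)^-1.
Proof. by rewrite /al exprVn exprMn !sqrtCK mulrC. Qed.

Let be2 j : be j ^+ 2 = - ((absj j)%:R / 2).
Proof. by rewrite /be exprMn exprVn exprMn !sqrtCK sqrCi mulrN1 invrN mulrN. Qed.

Let albe j : al j * be j = (2 * 'i)^-1.
Proof.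
rewrite -[2 in RHS](sqrtCK 2) /al /be; field.
by rewrite s20 rt0 neq0Ci.
Qed.

Lemma fps_conj_ev b j : fps_conj (mon C (ev b j)) = mon C (ev (~~ b) j).
Proof.
have E H n : fps_conj H n = (H (n.2, n.1))^* :> C by [].
apply/fpsP => -[m1 m2]; rewrite E !monE conjC_nat !evE.
by case: b; rewrite !xpair_eqE andbC.
Qed.

Lemma conj_v j : fps_conj (v j) = v (idx_opp j).
Proof.
rewrite !vE fps_conjZ fps_conjB !fps_conj_ev idx_oppK be_opp /=.
rewrite -opprB scalerN -scaleNr; congr (_ *: _).
have r (n : nat) : (sqrtC n%:R : C)^* = sqrtC n%:R.
  by apply: conj_Creal; rewrite ger0_real // sqrtC_ge0 ler0n.
by rewrite /be rmorphM fmorphV rmorphM /= !r conjCi mulrN invrN mulrN opprK.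
Qed.

Lemma sqnorm_u j : sqnorm (u j) = u j * u (idx_opp j).
Proof. by rewrite /sqnorm conj_u. Qed.

Lemma sqnorm_v j : sqnorm (v j) = v j * v (idx_opp j).
Proof. by rewrite /sqnorm conj_v. Qed.

Local Notation z b j := (mon C (ev b j)).

Lemma uu_mon j : u j * u (idx_opp j) = (2 * (absj j)%:R)^-1 *:
  ((z true j + z false (idx_opp j)) * (z true (idx_opp j) + z false j)).
Proof.
by rewrite !uE idx_oppK al_opp -scalerAl -scalerAr scalerA -expr2 al2.
Qed.

Lemma vv_mon j : v j * v (idx_opp j) = - ((absj j)%:R / 2) *:
  ((z true j - z false (idx_opp j)) * (z true (idx_opp j) - z false j)).
Proof.
by rewrite !vE idx_oppK be_opp -scalerAl -scalerAr scalerA -expr2 be2.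
Qed.

Lemma uv_mon j : u j * v (idx_opp j) = (2 * 'i)^-1 *:
  ((z true j + z false (idx_opp j)) * (z true (idx_opp j) - z false j)).
Proof.
by rewrite uE vE idx_oppK be_opp -scalerAl -scalerAr scalerA albe.
Qed.

(** ** Brackets of the Fourier coefficients *)

Section Box.
Variable N : nat.
Local Notation br := (pbr (R := R) (boxs N)).

Lemma pbrDl F G H : br (F + G) H = br F H + br G H.
Proof. by rewrite pbrC pbrDr opprD -!pbrC. Qed.

Lemma pbrZl a F G : br (a *: F) G = a *: br F G.
Proof. by rewrite pbrC pbrZr -scalerN -pbrC. Qed.

Lemma pbrNr F G : br F (- G) = - br F G.
Proof. by rewrite -scaleN1r pbrZr scaleN1r. Qed.

Lemma pbrNl F G : br (- F) G = - br F G.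
Proof. by rewrite -scaleN1r pbrZl scaleN1r. Qed.

Lemma pbrr F : br F F = 0.
Proof.
by rewrite pbrE big1 ?scaler0 // => j _; rewrite /pb mulrC subrr.
Qed.

Lemma pbr_ev b c i j : (absj i <= N)%N ->
  br (mon C (ev b i)) (mon C (ev c j)) =
  ('i * ((b && ~~ c)%:R - (~~ b && c)%:R)) *: (i == j)%:R.
Proof.
move=> iN; rewrite pbrE (bigD1_seq i) ?mem_boxs ?boxs_uniq //= big1 => [|k ki].
  rewrite addr0 /pb !d_ev eqxx -scalerA; congr (_ *: _).
  case: b; case: c; case: (i == j) => /=; rewrite ?mulr1n ?mulr0n;
    rewrite ?(mul0r, mulr0, mulr1, subr0, sub0r, subrr, scale0r, scale1r, scaler0,
              scaleN1r, oppr0) //.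
by rewrite /pb !d_ev (negbTE ki) !andbF mulr0n !mul0r subrr.
Qed.

Lemma pbr_uv i j : (absj i <= N)%N -> br (u i) (v j) = - (j == idx_opp i)%:R.
Proof.
move=> iN; rewrite uE vE pbrZl pbrZr pbrDl !pbrDr !pbrNr !pbr_ev ?absj_opp //=.
have -> : (i == idx_opp j) = (j == idx_opp i).
  by apply/eqP/eqP => ->; rewrite idx_oppK.
have -> : (idx_opp i == idx_opp j) = (i == j) by rewrite (inj_eq (can_inj idx_oppK)).
have e1 : 'i * (1 - 0) = 'i :> C by ring.
have e2 : 'i * (0 - 1) = - 'i :> C by ring.
rewrite (eq_sym (idx_opp i)) e1 e2 !subrr !mulr0 !scale0r sub0r subr0 scaleNr.
rewrite -opprD -scalerDl scalerN scalerN scalerA scalerA.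
case: (eqVneq j (idx_opp i)) => [->|_]; last by rewrite mulr0n scaler0.
have e3 : 'i + 'i = 2 * 'i :> C by ring.
rewrite be_opp albe e3 mulVf ?scale1r //.
by rewrite mulf_neq0 ?pnatr_eq0 ?neq0Ci.
Qed.

Lemma pbr_uu i j : (absj i <= N)%N -> br (u i) (u j) = 0.
Proof.
move=> iN; rewrite !uE pbrZl pbrZr pbrDl !pbrDr !pbr_ev ?absj_opp //=.
have -> : (i == idx_opp j) = (idx_opp i == j).
  by apply/eqP/eqP => [->|<-]; rewrite idx_oppK.
have -> : (idx_opp i == idx_opp j) = (i == j) by rewrite (inj_eq (can_inj idx_oppK)).
have e1 : 'i * (1 - 0) = 'i :> C by ring.
have e2 : 'i * (0 - 1) = - 'i :> C by ring.
by rewrite e1 e2 !subrr !mulr0 !scale0r add0r addr0 -scalerDl subrr scale0r !scaler0.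
Qed.

Lemma pbr_vv i j : (absj i <= N)%N -> br (v i) (v j) = 0.
Proof.
move=> iN; rewrite !vE pbrZl pbrZr pbrDl !pbrDr !pbrNr !pbrNl !pbr_ev ?absj_opp //=.
have -> : (i == idx_opp j) = (idx_opp i == j).
  by apply/eqP/eqP => [->|<-]; rewrite idx_oppK.
have -> : (idx_opp i == idx_opp j) = (i == j) by rewrite (inj_eq (can_inj idx_oppK)).
have e1 : 'i * (1 - 0) = 'i :> C by ring.
have e2 : 'i * (0 - 1) = - 'i :> C by ring.
rewrite e1 e2 !subrr !mulr0 !scale0r !oppr0 addr0 add0r -opprD -scalerDl subrr.
by rewrite scale0r oppr0 !scaler0.
Qed.

End Box.
End Kirchhoff.

(** * The sl(2) triples of the Fourier coefficients *)

(* The letters p, q, r, s stand for u_j, u_{-j}, v_j, v_{-j} at one level and p', q',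
   r', s' for the same at another level; e is 1 or 0 as the levels agree or not. *)
Section AbstractPairings.
Variables (A : comNzRingType) (br : A -> A -> A).
Hypotheses (brC : forall x y, br x y = - br y x)
  (brD : forall x, {morph br x : y z / y + z})
  (brM : forall x y z, br x (y * z) = br x y * z + y * br x z).
Variables (p q r s p' q' r' s' e : A).

Let brDl x y z : br (x + y) z = br x z + br y z.
Proof. by rewrite brC brD opprD -!brC. Qed.

Let brMl x y z : br (x * y) z = br x z * y + x * br y z.
Proof. by rewrite brC brM opprD -mulNr -mulrN -!brC. Qed.

Hypotheses (pp : br p p' = 0) (pq : br p q' = 0) (qp : br q p' = 0) (qq : br q q' = 0).
Hypotheses (rr : br r r' = 0) (rs : br r s' = 0) (sr : br s r' = 0) (ss : br s s' = 0).
Hypotheses (pr : br p r' = 0) (ps : br p s' = - e) (qr : br q r' = - e) (qs : br q s' = 0).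
Hypotheses (rp : br r p' = 0) (rq : br r q' = e) (sp : br s p' = e) (sq : br s q' = 0).

Let bE := (brDl, brD, brMl, brM, (pp, pq, qp, qq, rr, rs, sr, ss),
           (pr, ps, qr, qs, rp, rq, sp, sq)).

Lemma br_pq_pq : br (p * q + q * p) (p' * q' + q' * p') = 0.
Proof. by rewrite !bE; ring. Qed.

Lemma br_pq_rs : br (p * q + q * p) (r' * s' + s' * r') = - 4 * (p * s' + q * r') * e.
Proof. by rewrite !bE; ring. Qed.

Lemma br_pq_ps : br (p * q + q * p) (p' * s' + q' * r') = - 2 * (p * q' + q * p') * e.
Proof. by rewrite !bE; ring. Qed.

Lemma br_rs_ps : br (r * s + s * r) (p' * s' + q' * r') = 2 * (r * s' + s * r') * e.
Proof. by rewrite !bE; ring. Qed.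

Lemma br_ps_ps : br (p * s + q * r) (p' * s' + q' * r') =
  (p * s' - s * p' + q * r' - r * q') * e.
Proof. by rewrite !bE; ring. Qed.

End AbstractPairings.

Section Pairings.
Variable R : realType.
Local Notation C := R[i].
Local Notation u := (u_ R).
Local Notation v := (v_ R).
Local Notation z b j := (mon C (ev b j)).
Implicit Types F G : fps C.

Definition pairing (a b : idx -> fps C) (l : nat) : fps C :=
  a (jp l) * b (jm l) + a (jm l) * b (jp l).

Local Notation X := (pairing u u).
Local Notation Y := (pairing v v).
Local Notation W := (pairing u v).

Let jmK l : idx_opp (jm l) = jp l. Proof. exact: idx_oppK. Qed.

Let jp_eq k l : (jp k == jp l) = (k == l).
Proof. by apply/eqP/eqP => [/(congr1 absj)|->] //; rewrite !absj_jp => -[]. Qed.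

Let jm_eq k l : (jm k == jm l) = (k == l).
Proof. by rewrite /jm (inj_eq (can_inj idx_oppK)) jp_eq. Qed.

Let jpm_eq k l : (jp k == jm l) = false.
Proof. by apply/eqP => /(congr1 val). Qed.

Let jmp_eq k l : (jm k == jp l) = false.
Proof. by rewrite eq_sym jpm_eq. Qed.

Section Brackets.
Variable N : nat.
Local Notation br := (pbr (R := R) (boxs N)).
Implicit Types k l : 'I_N.

Let inp k : (absj (jp k) <= N)%N. Proof. by rewrite absj_jp. Qed.
Let inm k : (absj (jm k) <= N)%N. Proof. by rewrite absj_jm. Qed.

Let uu k l :
  [/\ br (u (jp k)) (u (jp l)) = 0, br (u (jp k)) (u (jm l)) = 0,
      br (u (jm k)) (u (jp l)) = 0 & br (u (jm k)) (u (jm l)) = 0].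
Proof. by split; apply: pbr_uu; rewrite ?inp ?inm. Qed.

Let vv k l :
  [/\ br (v (jp k)) (v (jp l)) = 0, br (v (jp k)) (v (jm l)) = 0,
      br (v (jm k)) (v (jp l)) = 0 & br (v (jm k)) (v (jm l)) = 0].
Proof. by split; apply: pbr_vv; rewrite ?inp ?inm. Qed.

Let uv k l :
  [/\ br (u (jp k)) (v (jp l)) = 0, br (u (jp k)) (v (jm l)) = - (k == l)%:R,
      br (u (jm k)) (v (jp l)) = - (k == l)%:R & br (u (jm k)) (v (jm l)) = 0].
Proof.
split; rewrite pbr_uv ?inp ?inm // ?jmK -/(jm k) ?jpm_eq ?jmp_eq ?jp_eq ?jm_eq;
  by rewrite ?mulr0n ?oppr0 // eq_sym.
Qed.

Let vu k l :
  [/\ br (v (jp k)) (u (jp l)) = 0, br (v (jp k)) (u (jm l)) = (k == l)%:R,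
      br (v (jm k)) (u (jp l)) = (k == l)%:R & br (v (jm k)) (u (jm l)) = 0].
Proof.
have [h1 h2 h3 h4] := uv l k; split; rewrite pbrC.
- by rewrite h1 oppr0.
- by rewrite h3 opprK eq_sym.
- by rewrite h2 opprK eq_sym.
- by rewrite h4 oppr0.
Qed.

Let brC := @pbrC R (boxs N).
Let brD := @pbrDr R (boxs N).
Let brM := @pbrMr R (boxs N).

Lemma brXX k l : br (X k) (X l) = 0.
Proof. by have [h1 h2 h3 h4] := uu k l; exact: (br_pq_pq brC brD brM h1 h2 h3 h4). Qed.

Lemma brYY k l : br (Y k) (Y l) = 0.
Proof. by have [h1 h2 h3 h4] := vv k l; exact: (br_pq_pq brC brD brM h1 h2 h3 h4). Qed.

Let at_diag (k l : 'I_N) (F G : fps C) :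
  (k = l -> F = G) -> F * (k == l)%:R = G *+ (k == l).
Proof. by case: eqP => [kl -> //|_ _]; rewrite ?mulr1 ?mulr1n // mulr0n mulr0. Qed.

Lemma brXY k l : br (X k) (Y l) = - 4 * W k *+ (k == l).
Proof.
have [h1 h2 h3 h4] := uv k l.
by apply: etrans (br_pq_rs brC brD brM h1 h2 h3 h4) (at_diag _) => ->.
Qed.

Lemma brXW k l : br (X k) (W l) = - 2 * X k *+ (k == l).
Proof.
have [h1 h2 h3 h4] := uu k l; have [g1 g2 g3 g4] := uv k l.
by apply: etrans (br_pq_ps brC brD brM h1 h2 h3 h4 g1 g2 g3 g4) (at_diag _) => ->.
Qed.

Lemma brYW k l : br (Y k) (W l) = 2 * Y k *+ (k == l).
Proof.
have [h1 h2 h3 h4] := vv k l; have [g1 g2 g3 g4] := vu k l.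
by apply: etrans (br_rs_ps brC brD brM h1 h2 h3 h4 g1 g2 g3 g4) (at_diag _) => ->.
Qed.

Lemma brWW k l : br (W k) (W l) = 0.
Proof.
have [h1 h2 h3 h4] := vv k l; have [g1 g2 g3 g4] := vu k l.
have [e1 e2 e3 e4] := uu k l; have [f1 f2 f3 f4] := uv k l.
apply: etrans (br_ps_ps brC brD brM e1 e2 e3 e4 h1 h2 h3 h4 f1 f2 f3 f4 g1 g2 g3 g4) _.
case: eqP => [->|_]; last by rewrite mulr0n mulr0.
move: (u _) (u _) (v _) (v _) => a b c d0; ring.
Qed.

Lemma br_const F a : br F a%:A = 0.
Proof.
have h : br F 1 = 0.
  by apply: (addrI (br F 1)); rewrite -{3}[1]mulr1 pbrMr mulr1 mul1r addr0.
by rewrite pbrZr h scaler0.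
Qed.

(** ** The constants *)

Definition nu (l : nat) : C := (l.+1 ^ 2)%:R.

Definition cst (k l : nat) : C := nu k * nu l / (nu k - nu l).

Lemma nu_neq k l : k != l -> nu k - nu l != 0.
Proof. by move=> kl; rewrite subr_eq0 eqr_nat eqn_exp2r. Qed.

Lemma cstC k l : (cst k l)%:A = - (cst l k)%:A :> fps C.
Proof.
rewrite -scaleNr; congr (_ *: _).
have [->|kl] := eqVneq k l; first by rewrite /cst subrr invr0 mulr0 oppr0.
have h1 := nu_neq kl; have h2 : nu l - nu k != 0 by rewrite nu_neq // eq_sym.
by rewrite /cst; move: (nu k) (nu l) h1 h2 => a b h1 h2; field; rewrite h1 h2.
Qed.

Let algM a b : a%:A * b%:A = (a * b)%:A :> fps C.
Proof. by rewrite -scalerAl mul1r scalerA. Qed.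

Lemma cst_nu k l : k != l ->
  (cst k l)%:A * ((nu k)%:A - (nu l)%:A) = (nu k)%:A * (nu l)%:A :> fps C.
Proof.
move=> kl; rewrite -scalerBl !algM; congr (_ *: _).
by rewrite /cst mulfVK // nu_neq.
Qed.

Lemma cst3 k l s : k != l -> k != s -> l != s ->
  (cst k l)%:A * (cst l s)%:A + (cst k s)%:A * (cst l k)%:A =
  (cst k s)%:A * (cst l s)%:A :> fps C.
Proof.
move=> kl ks ls; rewrite !algM -scalerDl; congr (_ *: _).
have h1 := nu_neq kl; have h2 := nu_neq ks; have h3 := nu_neq ls.
have h4 : nu l - nu k != 0 by rewrite nu_neq // eq_sym.
rewrite /cst; move: (nu k) (nu l) (nu s) h1 h2 h3 h4 => a b e h1 h2 h3 h4.
by field; rewrite h1 h2 h3 h4.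
Qed.

End Brackets.
End Pairings.

(** * The model with finitely many levels *)

Section BoxModel.
Variable R : realType.
Local Notation C := R[i].
Local Notation u := (u_ R).
Local Notation v := (v_ R).
Local Notation z b j := (mon C (ev b j)).
Implicit Types F G : fps C.

(** ** Balance, reality and order of the pairings *)

Definition balreal F : Prop := balanced F /\ real_fps F.

Lemma balrealD F G : balreal F -> balreal G -> balreal (F + G).
Proof. by move=> [? ?] [? ?]; split; [apply: balancedD | apply: real_fpsD]. Qed.

Lemma balrealN F : balreal F -> balreal (- F).
Proof. by move=> [? ?]; split; [apply: balancedN | apply: real_fpsN]. Qed.

Lemma balrealM F G : balreal F -> balreal G -> balreal (F * G).
Proof. by move=> [? ?] [? ?]; split; [apply: balancedM | apply: real_fpsM]. Qed.

Lemma balrealZ a F : a^* = a -> balreal F -> balreal (a *: F).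
Proof. by move=> ra [? ?]; split; [apply: balancedZ | apply: real_fpsZ]. Qed.

Lemma balreal1 : balreal 1.
Proof. by split; [apply: balanced1 | apply: real_fps1]. Qed.

Lemma balreal_sum I (r : seq I) (P : pred I) (f : I -> fps C) :
  (forall i, P i -> balreal (f i)) -> balreal (\sum_(i <- r | P i) f i).
Proof.
move=> h; split; [apply: balanced_sum => i /h[] // |].
by apply: real_fps_sum => i /h[].
Qed.

Lemma balrealX F n : balreal F -> balreal (F ^+ n).
Proof.
move=> f; elim: n => [|n IH]; first exact: balreal1.
by rewrite exprS; apply: balrealM.
Qed.

Lemma balreal_nat n : balreal n%:R.
Proof. by rewrite -scaler_nat; apply: balrealZ; [apply: conjC_nat | apply: balreal1]. Qed.

Let bal_zz b j : bal (ev b j + ev b (idx_opp j)).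
Proof.
move=> i; have := cntD true i (ev b j) (ev b (idx_opp j)).
have := cntD false i (ev b j) (ev b (idx_opp j)).
have := cntD true (idx_opp i) (ev b j) (ev b (idx_opp j)).
have := cntD false (idx_opp i) (ev b j) (ev b (idx_opp j)).
rewrite /cnt => -> -> -> ->.
have E c k e l : (if c then (ev e l).1 k else (ev e l).2 k) = (c == e) && (k == l) :> nat.
  exact: cnt_ev.
have E1 := E true; have E2 := E false; rewrite /= in E1 E2; rewrite !E1 !E2.
have -> : (idx_opp i == idx_opp j) = (i == j) by rewrite (inj_eq (can_inj idx_oppK)).
have -> : (idx_opp i == j) = (i == idx_opp j).
  by apply/eqP/eqP => [<-|->]; rewrite idx_oppK.
by case: b => /=; rewrite ?addn0 ?add0n addnC.
Qed.

Let bal_product j (e e' : C) :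
  balanced ((z true j + e *: z false (idx_opp j)) * (z true (idx_opp j) + e' *: z false j)).
Proof.
have h b c k l : bal (ev b k + ev c l) -> balanced (z b k * z c l).
  by move=> bb; rewrite -monD; apply: balanced_mon.
rewrite mulrDl !mulrDr -!scalerAl -!scalerAr.
apply: balancedD; apply: balancedD; try apply: balancedZ; try apply: balancedZ; apply: h.
- exact: bal_zz.
- by rewrite -ev_pair; apply: bal_pair.
- by rewrite addrC -ev_pair; apply: bal_pair.
- by have := bal_zz false (idx_opp j); rewrite idx_oppK.
Qed.

Lemma balanced_uu j : balanced (u j * u (idx_opp j)).
Proof.
by rewrite uu_mon; apply: balancedZ; have := @bal_product j 1 1; rewrite !scale1r.
Qed.

Lemma balanced_vv j : balanced (v j * v (idx_opp j)).
Proof.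
by rewrite vv_mon; apply: balancedZ; have := @bal_product j (-1) (-1); rewrite !scaleN1r.
Qed.

Lemma balanced_uv j : balanced (u j * v (idx_opp j)).
Proof.
by rewrite uv_mon; apply: balancedZ; have := @bal_product j 1 (-1);
   rewrite scale1r scaleN1r.
Qed.

Let jmK l : idx_opp (jm l) = jp l. Proof. exact: idx_oppK. Qed.

Let conj_pair (a b : idx -> fps C) l :
  (forall j, fps_conj (a j) = a (idx_opp j)) ->
  (forall j, fps_conj (b j) = b (idx_opp j)) -> real_fps (pairing a b l).
Proof.
move=> ha hb; apply/real_fpsP; rewrite fps_conjD !fps_conjM !ha !hb jmK addrC.
by [].
Qed.

Let bal_pairing (a b : idx -> fps C) l :
  (forall j, balanced (a j * b (idx_opp j))) -> balanced (pairing a b l).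
Proof.
by move=> h; apply: balancedD; first exact: h; have := h (jm l); rewrite jmK.
Qed.

Lemma balreal_X l : balreal (pairing u u l).
Proof. by split; [apply/bal_pairing/balanced_uu | apply: conj_pair => j; apply: conj_u]. Qed.

Lemma balreal_Y l : balreal (pairing v v l).
Proof. by split; [apply/bal_pairing/balanced_vv | apply: conj_pair => j; apply: conj_v]. Qed.

Lemma balreal_W l : balreal (pairing u v l).
Proof.
split; first exact/bal_pairing/balanced_uv.
by apply: conj_pair => j; [apply: conj_u | apply: conj_v].
Qed.

Let vord_z b j : vord 1 (z b j).
Proof. by rewrite -(mdeg_ev b j); apply: vord_mon. Qed.

Lemma vord_u j : vord 1 (u j).
Proof. by rewrite uE; apply: vordZ; apply: vordD; apply: vord_z. Qed.

Lemma vord_v j : vord 1 (v j).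
Proof. by rewrite vE; apply: vordZ; apply: vordB; apply: vord_z. Qed.

Lemma vord_pairing (a b : idx -> fps C) l :
  (forall j, vord 1 (a j)) -> (forall j, vord 1 (b j)) -> vord 2 (pairing a b l).
Proof. by move=> ha hb; apply: vordD; apply: (@vordM _ 1 1). Qed.

Lemma pairing_diag (a : idx -> fps C) l :
  pairing a a l = 2 *: (a (jp l) * a (idx_opp (jp l))).
Proof. by rewrite /pairing scaler_nat mulr2n [a (jm l) * _]mulrC. Qed.

Lemma quad_level l : (nu R l)%:A * pairing u u l + pairing v v l =
  (2 * l.+1%:R) *: (act R (jp l) + act R (jm l)).
Proof.
rewrite !pairing_diag uu_mon vv_mon absj_jp /act -/(jm l).
move: (z true (jp l)) (z false (jp l)) (z true (jm l)) (z false (jm l)) => a b e f.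
have k0 : l.+1%:R != 0 :> C by rewrite pnatr_eq0.
rewrite /nu natrX; move: (l.+1%:R : C) k0 => k k0; rewrite mulr_algl !scalerA.
have -> : k ^+ 2 * 2 / (2 * k) = k by field; rewrite k0.
have -> : 2 * - (k / 2) = - k by field.
rewrite scaleNr -scalerBr [2 * k]mulrC -scalerA; congr (_ *: _).
by rewrite scaler_nat; ring.
Qed.

(** ** The commuting family *)

Variable N : nat.
Local Notation br := (pbr (R := R) (boxs N)).

Let x (l : 'I_N) := pairing u u l.
Let y (l : 'I_N) := pairing v v l.
Let w (l : 'I_N) := pairing u v l.
Let nuA (l : 'I_N) : fps C := (nu R l)%:A.
Let cA (k l : 'I_N) : fps C := (cst R k l)%:A.

Definition DN : fps C := \sum_l nuA l * x l.
Definition AN : fps C := fps_sum [set: nat] (fun n => (- DN) ^+ n).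
Definition IN := gI x y w nuA cA AN.
Definition JN := gJ x y w nuA AN.

Lemma vord_x l : vord 2 (x l).
Proof. by apply: vord_pairing => j; apply: vord_u. Qed.

Lemma vord_y l : vord 2 (y l).
Proof. by apply: vord_pairing => j; apply: vord_v. Qed.

Lemma vord_w l : vord 2 (w l).
Proof. by apply: vord_pairing => j; [apply: vord_u | apply: vord_v]. Qed.

Lemma vord_DN : vord 2 DN.
Proof.
by apply: vord_sum => l _; rewrite /nuA mulr_algl; apply/vordZ/vord_x.
Qed.

Lemma AN_mulV : AN * (1 + DN) = 1.
Proof.
rewrite -[DN in 1 + DN]opprK; apply: fps_geometric.
by rewrite fpsN vord_DN ?oppr0 // mdeg0.
Qed.

Lemma balreal_alg a : a^* = a -> balreal a%:A.
Proof. by move=> ra; apply: balrealZ => //; apply: balreal1. Qed.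

Lemma balreal_nu l : balreal (nuA l).
Proof. by apply: balreal_alg; apply: conjC_nat. Qed.

Lemma balreal_cst k l : balreal (cA k l).
Proof.
apply: balreal_alg; rewrite /cst rmorphM fmorphV rmorphM rmorphB /=.
by rewrite !conjC_nat.
Qed.

Lemma balreal_DN : balreal DN.
Proof. by apply: balreal_sum => l _; apply: balrealM; [apply: balreal_nu | apply: balreal_X]. Qed.

Lemma balreal_AN : balreal AN.
Proof.
have gD := balreal_DN; split.
  by apply: balanced_fps_sum => n _; case: (balrealX n (balrealN gD)).
apply/real_fpsP; have := congr1 (@fps_conj R) AN_mulV.
rewrite fps_conjM fps_conjD fps_conj1; case: gD => _ /real_fpsP -> e.
by rewrite -[LHS]mulr1 -AN_mulV mulrCA e mulr1.
Qed.

Lemma balreal_gL k l : balreal (gL x y w k l).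
Proof.
apply: balrealD; [apply: balrealD; apply: balrealM | apply/balrealN/balrealM; last apply: balrealM].
- exact: balreal_X.
- exact: balreal_Y.
- exact: balreal_X.
- exact: balreal_Y.
- exact: balreal_nat.
- exact: balreal_W.
- exact: balreal_W.
Qed.

Lemma balreal_IN l : balreal (IN l).
Proof.
apply: balrealD; [apply: balrealD | apply: balreal_sum => k _].
- by apply: balrealM; [apply: balreal_nu | apply: balrealM; [apply: balreal_AN | apply: balreal_X]].
- exact: balreal_Y.
- by apply: balrealM; [apply: balreal_cst | apply: balreal_gL].
Qed.

Let balreal_pow (f : 'I_N -> fps C) n : (forall l, balreal (f l)) ->
  balreal (\sum_l nuA l ^+ n * f l).
Proof.
move=> h; apply: balreal_sum => l _; apply: balrealM => //.
by apply: balrealX; apply: balreal_nu.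
Qed.

Lemma balreal_JN n : balreal (JN n).
Proof.
have gD k : balreal (gD x nuA k) by apply: balreal_pow => l; apply: balreal_X.
have gB k : balreal (gB y nuA k) by apply: balreal_pow => l; apply: balreal_Y.
have gQ k : balreal (gQ w nuA k) by apply: balreal_pow => l; apply: balreal_W.
apply: balrealD; [apply: balrealD => // | apply: balreal_sum => k _].
  by apply: balrealM => //; apply: balreal_AN.
by apply: balrealD; [|apply: balrealN]; apply: balrealM.
Qed.

Let brC := @pbrC R (boxs N).
Let brD := @pbrDr R (boxs N).
Let brM := @pbrMr R (boxs N).
Let cC := fun k l : 'I_N => cstC R k l.

Lemma IN_commute k l : br (IN k) (IN l) = 0.
Proof.
have [->|kl] := eqVneq k l; first exact: pbrr.
exact: (gI_commute brC brD brM (@brXX R N) (@brYY R N) (@brWW R N) (@brXY R N)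
  (@brXW R N) (@brYW R N) (fun F l => br_const N F _) (fun F k l => br_const N F _)
  cC (fun k l h => cst_nu R h) (fun k l s h1 h2 h3 => cst3 R h1 h2 h3) AN_mulV kl).
Qed.

Lemma JN_commute l n : br (IN l) (JN n) = 0.
Proof.
have := gJ_commute (@pbrr R N) brC brD brM (@brXX R N) (@brYY R N) (@brWW R N)
  (@brXY R N) (@brXW R N) (@brYW R N) (fun F l => br_const N F _)
  (fun F k l => br_const N F _) cC (fun k l h => cst_nu R h)
  (fun k l s h1 h2 h3 => cst3 R h1 h2 h3) AN_mulV n l.
rewrite -/JN -/IN mulr_natl -scaler_nat pbrZr => /eqP.
by rewrite scaler_eq0 pnatr_eq0 /= => /eqP.
Qed.

(** The factor A = 1 - A D_1 differs from 1 only by terms of degree two. *)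
Lemma vord_IN l : vord 3 (IN l - (2 * (l : nat).+1%:R) *: (act R (jp l) + act R (jm l))).
Proof.
have e : IN l - (nuA l * x l + y l) =
    \sum_(s | s != l) cA l s * gL x y w l s - nuA l * (AN * DN * x l).
  have h : AN * DN = 1 - AN.
    by have := AN_mulV; rewrite mulrDr mulr1 => <-; rewrite addrC addKr.
  by rewrite h /IN /gI; ring.
rewrite -quad_level -/(x l) -/(y l) -/(nuA l) e.
have o4 (F G : fps C) : vord 2 F -> vord 2 G -> vord 3 (F * G).
  by move=> oF oG; apply: (vordW _ (vordM oF oG)).
apply: vordB.
  apply: vord_sum => s _; rewrite /cA mulr_algl; apply: vordZ.
  apply: vordB; [apply: vordD |]; first exact: o4 (vord_x _) (vord_y _).
    exact: o4 (vord_x _) (vord_y _).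
  by rewrite mulr_natl -scaler_nat; apply: vordZ; apply: o4 (vord_w _) (vord_w _).
rewrite /nuA mulr_algl; apply: vordZ; apply: o4 (vord_x _).
exact: (@vordM _ 0 2 _ _ (@vord0 _ _) vord_DN).
Qed.

End BoxModel.

(** * From the model to the series *)

Section Reduction.
Variable R : realType.
Local Notation C := R[i].
Local Notation u := (u_ R).
Local Notation v := (v_ R).
Implicit Types F G : fps C.

Lemma fps_sum_S l (f : idx -> fps C) :
  fps_sum (S_ (l.+1 ^ 2)) f = f (jp l) + f (jm l).
Proof.
have SE j : S_ (l.+1 ^ 2) j <-> j = jp l \/ j = jm l.
  split=> [|[->|->]]; rewrite /S_ /=; last 2 first.
  - by rewrite -[(l.+1 ^ 2)%N]/(l.+1 * l.+1)%N PoszM.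
  - by rewrite -[(l.+1 ^ 2)%N]/(l.+1 * l.+1)%N PoszM sqrrN.
  have -> : Posz (l.+1 ^ 2) = (Posz l.+1) ^+ 2.
    by rewrite -[(l.+1 ^ 2)%N]/(l.+1 * l.+1)%N PoszM.
  move/eqP; rewrite eqf_sqr => /orP[]/eqP e; [left | right]; exact/val_inj.
have jpm : jp l != jm l by apply/eqP => /(congr1 val).
apply/fpsP => m; rewrite fpsD [LHS]/= (fsbigE [:: jp l; jm l]).
- have h1 : jp l \in (S_ (l.+1 ^ 2) : set idx) by apply/mem_set/SE; left.
  have h2 : jm l \in (S_ (l.+1 ^ 2) : set idx) by apply/mem_set/SE; right.
  by rewrite !big_cons big_nil h1 h2 /= addr0.
- by rewrite cons_uniq mem_seq1 jpm.
- by move=> j /=; rewrite !inE => /orP[]/eqP ->; apply/SE; [left | right].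
- by move=> j /SE[]->; rewrite !inE eqxx ?orbT.
Qed.

Section Box.
Variable N : nat.
Local Notation "F =N G" := (eqN N F G) (at level 70).

Let x (l : 'I_N) := pairing u u l.
Let y (l : 'I_N) := pairing v v l.
Let w (l : 'I_N) := pairing u v l.
Let nuA (l : 'I_N) : fps C := (nu R l)%:A.
Let cA (k l : 'I_N) : fps C := (cst R k l)%:A.
Local Notation AN := (AN R N).
Local Notation DN := (DN R N).

Lemma ev_out b j : (N < absj j)%N -> mon C (ev b j) =N 0.
Proof.
move=> Nj m mN; rewrite monE; case: eqP => // me.
by have := mN b j Nj; rewrite me cnt_ev !eqxx.
Qed.

Lemma u_out j : (N < absj j)%N -> u j =N 0.
Proof.
move=> Nj m mN; rewrite uE fpsZ fpsD !(ev_out _ _ mN) ?absj_opp //.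
by rewrite addr0 mulr0.
Qed.

Lemma v_out j : (N < absj j)%N -> v j =N 0.
Proof.
move=> Nj m mN; rewrite vE fpsZ fpsD fpsN !(ev_out _ _ mN) ?absj_opp //.
by rewrite subr0 mulr0.
Qed.

Lemma out_mulr F G : F =N 0 -> F * G =N 0.
Proof. by move=> h; rewrite -(mul0r G); apply: eqN_mul. Qed.

Lemma out_mull F G : G =N 0 -> F * G =N 0.
Proof. by rewrite mulrC; apply: out_mulr. Qed.

Lemma out_scale a F : F =N 0 -> a *: F =N 0.
Proof. by move=> h; rewrite -(scaler0 _ a); apply: eqN_scale. Qed.

Let weight (n : nat) l F : (l.+1 ^ (2 * n))%:R *: F = ((nu R l)%:A : fps C) ^+ n * F.
Proof.
have -> : (nu R l)%:A ^+ n = (nu R l ^+ n)%:A :> fps C.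
  elim: n => [|n IH]; first by rewrite !expr0 scale1r.
  by rewrite !exprS IH -scalerAl mul1r scalerA.
by rewrite mulr_algl /nu -natrX -expnM.
Qed.

Lemma weighted_sum (n : nat) (f : idx -> fps C) (g : nat -> fps C) :
  (forall j, (N < absj j)%N -> f j =N 0) ->
  (forall l, f (jp l) + f (jm l) = g l) ->
  fps_sum [set: idx] (fun j => (absj j ^ (2 * n))%:R *: f j) =N
  \sum_(l < N) (nu R l)%:A ^+ n * g l.
Proof.
move=> f0 fg; apply: eqN_trans (eqN_fps_sumT _) _.
  by move=> j Nj; apply: out_scale; apply: f0.
by apply: eqN_sum => l _; rewrite absj_jp absj_jm -scalerDr fg weight.
Qed.

Let jmK l : idx_opp (jm l) = jp l. Proof. exact: idx_oppK. Qed.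

Let pairing_conj (a b : idx -> fps C) l :
  (forall j, fps_conj (b j) = b (idx_opp j)) ->
  a (jp l) * fps_conj (b (jp l)) + a (jm l) * fps_conj (b (jm l)) = pairing a b l.
Proof. by move=> hb; rewrite !hb jmK. Qed.

Lemma D_eqN n : D_ R n =N gD x nuA n.
Proof.
apply: (@weighted_sum n (fun j => sqnorm (u j)) (pairing u u)) => [j Nj|l].
  by rewrite sqnorm_u; apply: out_mulr; apply: u_out.
exact: (@pairing_conj u u l (@conj_u R)).
Qed.

Lemma B_eqN n : B_ R n =N gB y nuA n.-1.
Proof.
rewrite /B_ (_ : (2 * n - 2)%N = (2 * n.-1)%N); last by lia.
apply: (@weighted_sum n.-1 (fun j => sqnorm (v j)) (pairing v v)) => [j Nj|l].
  by rewrite sqnorm_v; apply: out_mulr; apply: v_out.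
exact: (@pairing_conj v v l (@conj_v R)).
Qed.

Lemma Q_eqN n : Q_ R n =N gQ w nuA n.-1.
Proof.
rewrite /Q_ (_ : (2 * n - 2)%N = (2 * n.-1)%N); last by lia.
apply: (@weighted_sum n.-1 (fun j => u j * fps_conj (v j)) (pairing u v)) => [j Nj|l].
  by apply: out_mulr; apply: u_out.
exact: (@pairing_conj u v l (@conj_v R)).
Qed.

Lemma Ainv_eqN : Ainv R =N 1 + DN.
Proof.
apply: eqN_add => //; apply: eqN_trans (D_eqN 1) _.
by rewrite /gD; apply: eqN_sum => l _; rewrite expr1.
Qed.

Lemma A_eqN : A_ R =N AN.
Proof.
have e : A_ R * (1 + DN) =N 1.
  apply: eqN_trans (eqN_mul (@eqN_refl _ _ _) (eqN_sym Ainv_eqN)) _.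
  by rewrite A_mulV; exact: eqN_refl.
have inv (a b d' : fps C) : a * d' = 1 -> b = a * (b * d').
  by move=> ad; rewrite mulrCA ad mulr1.
rewrite (inv _ (A_ R) _ (AN_mulV R N)) -[X in _ =N X]mulr1.
exact: eqN_mul (@eqN_refl _ _ _) e.
Qed.

Let pair_sum (a b : idx -> fps C) l l' :
  (forall j, fps_conj (a j) = a (idx_opp j)) ->
  (forall j, fps_conj (b j) = b (idx_opp j)) ->
  let s j k := sqnorm (a j * b k - a k * b j) in
  s (jp l) (jp l') + s (jp l) (jm l') + (s (jm l) (jp l') + s (jm l) (jm l')) =
  pairing a a l * pairing b b l' + pairing a a l' * pairing b b l
    - 2 * (pairing a b l * pairing a b l').
Proof.
move=> ha hb s.
have sE j k : s j k = (a j * b k - a k * b j) *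
    (a (idx_opp j) * b (idx_opp k) - a (idx_opp k) * b (idx_opp j)).
  by rewrite /s /sqnorm fps_conjB !fps_conjM !ha !hb.
rewrite !sE !jmK -!/(jm _) /pairing {s sE}.
move: (a (jp l)) (a (jm l)) (a (jp l')) (a (jm l')) => p q p' q'.
move: (b (jp l)) (b (jm l)) (b (jp l')) (b (jm l')) => r s r' s'.
by ring.
Qed.

Let assemble (a : C) (F F' s1 s2 t1 t2 S1 S2 G H K : fps C) :
  F =N F' -> s1 + s2 = G -> t1 + t2 = H -> S1 + S2 = K ->
  (a *: (F * s1) + t1 + S1) + (a *: (F * s2) + t2 + S2) =N a%:A * (F' * G) + H + K.
Proof.
move=> FF <- <- <-.
have -> : (a *: (F * s1) + t1 + S1) + (a *: (F * s2) + t2 + S2) =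
    a%:A * (F * (s1 + s2)) + (t1 + t2) + (S1 + S2).
  by rewrite -!(mulr_algl a (_ * _)); ring.
apply: eqN_add; last exact: eqN_refl.
apply: eqN_add; last exact: eqN_refl.
by apply: eqN_mul; [|apply: eqN_mul].
Qed.

Lemma I_eqN (l : 'I_N) : I_ R l.+1 =N IN R l.
Proof.
pose s j k := sqnorm (u j * v k - u k * v j).
have s_out j k : (N < absj k)%N -> s j k =N 0.
  move=> Nk; apply: out_mulr; rewrite -(subr0 0); apply: eqN_sub.
    by apply: out_mull; apply: v_out.
  by apply: out_mulr; apply: u_out.
have inner j : fps_sum (Lambda `\ (l.+1 ^ 2)%N) (fun nu' => fps_sum (S_ nu') (fun k =>
      (((l.+1 ^ 2) * nu')%:R / ((l.+1 ^ 2)%:R - nu'%:R) : C) *: s j k)) =N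
    \sum_(l' < N | l' != l) cst R l l' *: (s j (jp l') + s j (jm l')).
  pose r := [seq (l'.+1 ^ 2)%N | l' <- iota 0 N & l' != l :> nat].
  have ri l' : ((l'.+1 ^ 2)%N \in r) = (l' < N)%N && (l' != l :> nat).
    rewrite /r (mem_map (f := fun k => k.+1 ^ 2)%N) ?mem_filter ?mem_iota 1?andbC //.
    by move=> a b /eqP; rewrite eqn_exp2r // => /eqP[].
  apply: eqN_trans (@eqN_fps_sum _ _ _ _ _ r _ _ _) _.
  - rewrite map_inj_uniq ?filter_uniq ?iota_uniq // => a b /eqP.
    by rewrite eqn_exp2r // => /eqP[].
  - move=> t tr; have /mapP[l' _ tE] := tr; move: tr; rewrite tE ri => /andP[_ ll].
    split; first by exists l'.+1.
    by move=> /eqP; rewrite eqn_exp2r // eqSS (negbTE ll).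
  - move=> t [[[//|l'] _ <-] tl]; rewrite ri negb_and negbK -leqNgt => /orP[Nl|/eqP ll].
      rewrite fps_sum_S -[0]addr0; apply: eqN_add; apply: out_scale; apply: s_out;
      by rewrite ?absj_jp ?absj_jm ltnS.
    by case: tl; rewrite ll.
  have rE : iota 0 N = index_iota 0 N by rewrite /index_iota subn0.
  rewrite /r big_map big_filter rE big_mkord.
  rewrite (eq_bigl (fun l' : 'I_N => l' != l)) //.
  apply: eqN_sum => l' _; rewrite fps_sum_S -scalerDr /cst /nu natrM.
  exact: eqN_refl.
rewrite /I_ /I1 fps_sum_S.
apply: eqN_trans (eqN_add (eqN_add (@eqN_refl _ _ _) (inner _))
  (eqN_add (@eqN_refl _ _ _) (inner _))) _.
have hX : sqnorm (u (jp l)) + sqnorm (u (jm l)) = x l.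
  exact: (@pairing_conj u u l (@conj_u R)).
have hY : sqnorm (v (jp l)) + sqnorm (v (jm l)) = y l.
  exact: (@pairing_conj v v l (@conj_v R)).
have hS : \sum_(l' < N | l' != l) cst R l l' *: (s (jp l) (jp l') + s (jp l) (jm l'))
    + \sum_(l' < N | l' != l) cst R l l' *: (s (jm l) (jp l') + s (jm l) (jm l'))
    = \sum_(l' < N | l' != l) cA l l' * gL x y w l l'.
  rewrite -big_split; apply: eq_bigr => l' _ /=.
  by rewrite -scalerDr (@pair_sum u v l l' (@conj_u R) (@conj_v R)) -mulr_algl.
exact: assemble A_eqN hX hY hS.
Qed.

Let EN j := gB y nuA j.-1 * (1 + DN) + AN * gD x nuA j.
Let FN j := gB y nuA j.-1 * (1 + DN) - AN * gD x nuA j.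

Let B1 j : B_ R j * Ainv R =N gB y nuA j.-1 * (1 + DN).
Proof. exact: eqN_mul (B_eqN j) Ainv_eqN. Qed.

Let D1 j : A_ R * D_ R j =N AN * gD x nuA j.
Proof. exact: eqN_mul A_eqN (D_eqN j). Qed.

Lemma E_eqN j : E_ R j =N EN j.
Proof. exact: eqN_add (B1 j) (D1 j). Qed.

Lemma F_eqN j : F_ R j =N FN j.
Proof. exact: eqN_sub (B1 j) (D1 j). Qed.

Let gD1 : gD x nuA 1 = DN.
Proof. by apply: eq_bigr => l _; rewrite expr1. Qed.

Lemma J_eqN n : J_ R n.+2 =N JN R N n.+1.
Proof.
pose JE := EN n.+2 - \sum_(2 <= j < n.+3) gQ w nuA j.-1 * gQ w nuA (n.+2 + 2 - j).-1
  + (4^-1 : C) *: \sum_(2 <= j < n.+2) (EN j * EN (n.+3 - j)%N - FN j * FN (n.+3 - j)%N).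
have JEE : J_ R n.+2 =N JE.
  apply: eqN_add.
    apply: eqN_sub; first exact: E_eqN.
    by apply: eqN_sum => j _; apply: eqN_mul; apply: Q_eqN.
  apply: eqN_scale; apply: eqN_sum => j _; rewrite addn1.
  by apply: eqN_sub; apply: eqN_mul; [apply: E_eqN | apply: E_eqN | apply: F_eqN ..].
apply: eqN_trans JEE _.
suff -> : JE = JN R N n.+1 by exact: eqN_refl.
have e4 (F : fps C) : (4^-1 : C) *: (4 * F) = F.
  by rewrite mulr_natl -(scaler_nat _ F) scalerA mulVf ?pnatr_eq0 // scale1r.
rewrite /JE (sum_EE_FF x y nuA n.+1 (AN_mulV R N)) e4 [n.+1.-1]/=.
rewrite (big_addn 0 n.+3 2) big_mkord subSS /EN /JN /gJ [n.+2.-1]/=.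
have -> : \sum_(i < n.+2 - 1) gQ w nuA (i + 2).-1 * gQ w nuA (n.+2 + 2 - (i + 2)).-1
    = \sum_(i < n.+1) gQ w nuA (n.+1 - i) * gQ w nuA i.+1.
  rewrite subSS subn0; apply: eq_bigr => i _; rewrite mulrC !addn2 !subSS.
  have -> : ((n.+2 - i).-1 = n.+1 - i)%N by move: (nat_of_ord i) => k; lia.
  by rewrite [i.+2.-1]/=.
rewrite sumrB [X in _ = _ + (X - _)]big_ord_recr /= subSnn gD1.
move: (gD _ _ _) (gB _ _ _) (\sum_(i < n) _) (\sum_(i < n.+1) _) => d b s1 s2.
by ring.
Qed.

(** The member A D_1 + B_1 = 1 - A + B_1 of the family J, of index one, is 2 H + 1. *)
Lemma H_eqN : H_ R =N 2^-1 *: (JN R N 0 - 1).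
Proof.
rewrite /H_ -scalerBr; apply: eqN_scale.
apply: eqN_trans (eqN_sub (B_eqN 1) A_eqN) _.
suff -> : JN R N 0 - 1 = gB y nuA 0 - AN by exact: eqN_refl.
rewrite /JN /gJ big_ord0 addr0 -/nuA gD1.
have := AN_mulV R N; move: (gB _ _ _) => b e; rewrite -[X in _ - X = _]e; ring.
Qed.

End Box.

(** ** Consequences for the series themselves *)

Let c (l : nat) : C := 2 * l.+1%:R.
Let I (l : nat) : fps C := I_ R l.+1.

Let I_box l N (lN : (l.+1 <= N)%N) : eqN N (I l) (IN R (Ordinal lN)).
Proof. exact: (I_eqN (Ordinal lN)). Qed.

Lemma I_balanced l : balanced (I l).
Proof.
apply: (@balanced_eqN _ l.+1) => N lN; exists (IN R (Ordinal lN)); first exact: I_box.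
by case: (balreal_IN R (Ordinal lN)).
Qed.

Lemma I_real l : real_fps (I l).
Proof.
apply: (@real_fps_eqN _ l.+1) => N lN; exists (IN R (Ordinal lN)); first exact: I_box.
by case: (balreal_IN R (Ordinal lN)).
Qed.

Lemma I_quad l : vord 3 (I l - quad c l).
Proof.
move=> m m3; have [N0 mN0] := box_exists m; pose N := maxn l.+1 N0.
have lN : (l.+1 <= N)%N by apply: leq_maxl.
have mN : box N m by apply: boxW mN0; apply: leq_maxr.
rewrite fpsD (I_box lN mN); exact: (vord_IN R (Ordinal lN) m3).
Qed.

Lemma poisson_I_box G l n0 : (forall N, (n0 <= N)%N -> exists2 G', eqN N G G' &
    forall k : 'I_N, pbr (boxs N) (IN R k) G' = 0) -> poisson (I l) G = 0.
Proof.
move=> h; apply: (@eqN_ext _ (maxn l.+1 n0)) => N; rewrite geq_max => /andP[lN nN].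
have [G' GG IG] := h N nN.
apply: eqN_trans (poisson_box G (@I_balanced l)) _.
apply: eqN_trans (eqN_pbr (I_box lN) GG) _.
by rewrite IG; exact: eqN_refl.
Qed.

Lemma I_commute k l : poisson (I k) (I l) = 0.
Proof.
apply: (@poisson_I_box _ _ l.+1) => N lN; exists (IN R (Ordinal lN)); first exact: I_box.
by move=> k'; apply: IN_commute.
Qed.

Lemma J_commute k n : poisson (I k) (J_ R n.+2) = 0.
Proof.
apply: (@poisson_I_box _ _ 0) => N _; exists (JN R N n.+1); first exact: J_eqN.
by move=> k'; apply: JN_commute.
Qed.

Lemma H_commute k : poisson (I k) (H_ R) = 0.
Proof.
apply: (@poisson_I_box _ _ 0) => N _; exists (2^-1 *: (JN R N 0 - 1)); first exact: H_eqN.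
move=> k'; rewrite pbrZr pbrDr JN_commute add0r pbrNr.
by rewrite -[X in - pbr _ _ X]scale1r br_const oppr0 scaler0.
Qed.

Let balreal_box G : (forall N, exists2 G', eqN N G G' & balreal G') -> balreal G.
Proof.
move=> h; split.
  by apply: (@balanced_eqN _ 0) => N _; have [G' GG []] := h N; exists G'.
by apply: (@real_fps_eqN _ 0) => N _; have [G' GG []] := h N; exists G'.
Qed.

Lemma balreal_J n : balreal (J_ R n.+2).
Proof.
by apply: balreal_box => N; exists (JN R N n.+1); [apply: J_eqN | apply: balreal_JN].
Qed.

Lemma balreal_H : balreal (H_ R).
Proof.
apply: balreal_box => N; exists (2^-1 *: (JN R N 0 - 1)); first exact: H_eqN.
apply: balrealZ; first by rewrite fmorphV /= conjC_nat.
by apply: balrealD; [apply: balreal_JN | apply/balrealN/balreal1].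
Qed.

Definition kirchhoff_generator : fps C := generator c I.

Let c0 l : c l != 0.
Proof. by rewrite mulf_neq0 ?pnatr_eq0. Qed.

Let cR l : (c l)^* = c l.
Proof. by rewrite rmorphM /= !conjC_nat. Qed.

Local Notation S := kirchhoff_generator.

Let bS : balanced S. Proof. exact: generator_balanced I_balanced. Qed.
Let oS : vord 3 S. Proof. exact: generator_vord. Qed.
Let rS : real_fps S. Proof. exact: generator_real cR I_balanced I_real. Qed.

Lemma kirchhoff_generator_in_F1 : in_F1 S.
Proof.
split; last exact: oS.
split; [by move=> m m1; apply: oS; apply: leq_ltn_trans m1 _ | exact: rS |].
by move=> m /eqP m0; apply: bS => /momentum_bal.
Qed.

Lemma normal_form_commuting G : balreal G -> (forall k, poisson (I k) G = 0) ->
  normal_form (exp_ad S G).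
Proof.
move=> [bG rG] cG; apply: normal_form_normal_fps.
  exact: (exp_normal c0 I_balanced I_quad I_commute bG cG).
exact: (exp_ad_real bS oS rS rG).
Qed.

(** Balanced series commute with M_j, a multiple of |z_j|^2 - |z_{-j}|^2. *)
Lemma M_invariant j : exp_ad S (M_ R j) = M_ R j.
Proof.
apply: (exp_ad_id bS oS).
have ME : M_ R j = ('i / 2) *: (act R j - act R (idx_opp j)).
  have e := uv_mon R j; have e' := uv_mon R (idx_opp j); rewrite idx_oppK in e'.
  apply: etrans (congr2 (fun s t : fps C => 2^-1 *: (s - t)) e e') _.
  rewrite -scalerBr scalerA /act.
  move: (mon C (ev true j)) (mon C (ev false (idx_opp j))) => a f.
  move: (mon C (ev true (idx_opp j))) (mon C (ev false j)) => b g.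
  have -> : (a + f) * (b - g) - (b + g) * (a - f) = (- 2 : C) *: (a * g - b * f).
    by rewrite scaleNr scaler_nat; ring.
  rewrite scalerA; congr (_ *: _).
  have i0 : 'i != 0 :> C := neq0Ci _.
  transitivity (- ('i ^+ 2)^-1 * 'i / 2 : C); last by rewrite sqrCi invrN invr1 opprK mul1r.
  by move: 'i i0 => t t0; field; rewrite t0.
apply/fpsP => m; rewrite ME poissonZr // poissonBr // fpsZ fpsD fpsN !poisson_act.
have [bm|bm] := pselect (bal m); last by rewrite bS // !mulr0 subr0 mulr0.
have -> : (m.1 j)%:R - (m.2 j)%:R =
    (m.1 (idx_opp j))%:R - (m.2 (idx_opp j))%:R :> C.
  have /(congr1 (fun n => n%:R : C)) := bm j; rewrite !natrD => /eqP.
  rewrite -subr_eq0 => /eqP h; apply/eqP; rewrite -subr_eq0; apply/eqP.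
  by apply: etrans h; ring.
by rewrite subrr mulr0.
Qed.

End Reduction.

Theorem theorem1p6 (R : realType) :
  (forall k l : nat, (1 <= k)%N -> (1 <= l)%N -> poisson (I_ R k) (I_ R l) = 0)
  /\ exists S : fps R[i],
    [/\ in_F1 S,
        forall j : idx, exp_ad S (M_ R j) = M_ R j,
        forall k : nat, (1 <= k)%N -> normal_form (exp_ad S (I_ R k)),
        forall k : nat, (2 <= k)%N -> normal_form (exp_ad S (J_ R k))
      & normal_form (exp_ad S (H_ R))].
Proof.
split=> [[|k] // [|l] // _ _|]; first exact: I_commute.
exists (kirchhoff_generator R); split.
- exact: kirchhoff_generator_in_F1.
- exact: M_invariant.
- move=> [|k] // _; apply: normal_form_commuting => [|l]; last exact: I_commute.
  by split; [apply: I_balanced | apply: I_real].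
- move=> [|[|n]] // _; apply: normal_form_commuting => [|l]; last exact: J_commute.
  exact: balreal_J.
- apply: normal_form_commuting => [|l]; last exact: H_commute.
  exact: balreal_H.
Qed.
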